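(* Fix an arbitrary total order $\prec$ on the set of isomorphism classes of primitive rule diagrams, with the classes indexed as $\mathfrak d_p$, $p\in\mathcal I_{\mathcal P}$, in accordance with the order ($p<q$ iff $\mathfrak d_p\prec\mathfrak d_q$), and let $d_p\in\mathcal D$ be the associated basis vectors. Then every basis diagram $d=\biguplus_{i=1}^{n_c}d_{p_i}$ (a disjoint union of $n_c$ primitive rule diagrams, repetitions among the indices $p_i$ allowed) can be uniquely represented as $$d=t_0\cdot d_\emptyset+\sum_{i=1}^{n_c}\ \sum_{\substack{p_1,\dots,p_i\in\mathcal I_{\mathcal P}\\ p_1\le p_2\le\dots\le p_i}}t_{p_1\dots p_i}\ d_{p_1}*_{\mathcal D}\cdots*_{\mathcal D}d_{p_i}$$ with coefficients $t_0,t_{p_1\dots p_i}\in\mathbb K$ (only finitely many of them non-zero).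
   Context: $\mathbb K$ is a field (such as $\mathbb R$ or $\mathbb C$). Relations. For finite sets $A,B$ a relation is a subset $R\subseteq A\times B$; $S\circ R=\{(a,c)\mid \exists b:(a,b)\in R,(b,c)\in S\}$; for a relation $R$ on one set, $R^*$ is its reflexive transitive closure. $R$ is one-to-one if distinct pairs in $R$ differ in both entries. Graphs and linear rules. A graph is a finite directed multigraph $G=(V_G,E_G,s_G,t_G)$ (loops allowed). A linear rule $r:I\rightharpoonup O$ is an injective partial graph morphism: a pair of one-to-one relations $r\subseteq (V_I\times V_O)\uplus(E_I\times E_O)$ such that for edges $(e,e')\in r$ implies $(s(e),s(e')),(t(e),t(e'))\in r$. It is connected if it is not empty and is not a disjoint union of two non-empty rules. Rule diagrams. A rule diagram $\mathfrak d=(I,O,r,m,s,t)$ consists of graphs $I=\biguplus_{i=1}^n I_i$, $O=\biguplus_{i=1}^n O_i$ (with $s,t$ the source and target maps of $I\uplus O$), $r=\biguplus_i r_i$ with each $r_i:I_i\rightharpoonup O_i$ a connected linear rule, and a one-to-one relation $m=\biguplus_{i<j}m_{i,j}$, where $m_{i,j}\subseteq (V_{O_j}\times V_{I_i})\uplus(E_{O_j}\times E_{I_i})$, such that with $\omega_m:=m\circ(r\circ m)^*$: for all edges, $(e,e')\in\omega_m$ implies $(s(e),s(e')),(t(e),t(e'))\in\omega_m$. The numbering of constituents is not part of the data; the empty rule diagram has $n=0$. Isomorphisms are pairs of graph isomorphisms $i_I:I\to I'$, $i_O:O\to O'$ with $r'=i_O r i_I^{-1}$, $m'=i_I m i_O^{-1}$.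 $\mathcal D$ is the $\mathbb K$-vector space with basis the set $\mathfrak D$ of isomorphism classes of rule diagrams (a rule diagram and its basis vector are denoted alike; $d_\emptyset$ is the basis vector of the empty diagram). The bilinear composition on $\mathcal D$ is $\mathfrak d_A*_{\mathcal D}\mathfrak d_B=\sum_{m_{AB}}(I_A\uplus I_B,O_A\uplus O_B,r_A\uplus r_B,m_A\uplus m_{AB}\uplus m_B,s_A\uplus s_B,t_A\uplus t_B)$, the sum being over all one-to-one relations $m_{AB}$ from $O_B$ to $I_A$ (vertices to vertices, edges to edges; $m_{AB}=\emptyset$ allowed) for which the displayed tuple is a rule diagram. This makes $\mathcal D$ an associative algebra with unit $d_\emptyset$. Primitive diagrams. $\uplus$ is the componentwise disjoint union of rule diagrams. A non-empty rule diagram is primitive if it is not a disjoint union of two non-empty rule diagrams; every rule diagram is a disjoint union of primitive ones, unique up to order. *)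

(* Defs.v *)
From HB Require Import structures.
From mathcomp Require Import all_boot all_order all_algebra.
From mathcomp Require Import generic_quotient boolp finmap.
From mathcomp Require Import monalg.
Set Implicit Arguments.
Unset Strict Implicit.
Unset Printing Implicit Defensive.
Import GRing.Theory.
Local Open Scope ring_scope.

Definition one_to_one (A B : finType) (R : {set A * B}) : Prop :=
  forall p q, p \in R -> q \in R -> p <> q -> p.1 <> q.1 /\ p.2 <> q.2.

Definition rel_comp (A B C : finType) (S : {set B * C}) (R : {set A * B}) :
    {set A * C} :=
  [set ac | [exists b, ((ac.1, b) \in R) && ((b, ac.2) \in S)]].

Definition rel_star (A : finType) (R : {set A * A}) : {set A * A} :=
  [set p | connect (fun x y => (x, y) \in R) p.1 p.2].

Definition omega (O I : finType) (m : {set O * I}) (r : {set I * O}) :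
    {set O * I} :=
  rel_comp m (rel_star (rel_comp r m)).

(* For bijective [f] and [g] this is the relation [g o R o f^-1]. *)
Definition rel_image (A B C D : finType) (f : A -> C) (g : B -> D)
    (R : {set A * B}) : {set C * D} :=
  [set (f p.1, g p.2) | p in R].

Definition rel_sum (A B C D : finType) (R : {set A * C}) (S : {set B * D}) :
    {set (A + B) * (C + D)} :=
  [set p | match p with
           | (inl a, inl c) => (a, c) \in R
           | (inr b, inr d) => (b, d) \in S
           | _ => false
           end].

(* The relation [R + T + S] between the sums, where the additional part [T]
   goes from the second summand of the source to the first one of the target. *)
Definition rel_glue (A B C D : finType) (R : {set A * C}) (T : {set B * C})
    (S : {set B * D}) : {set (A + B) * (C + D)} :=
  [set p | match p with
           | (inl a, inl c) => (a, c) \in R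
           | (inr b, inl c) => (b, c) \in T
           | (inr b, inr d) => (b, d) \in S
           | (inl _, inr _) => false
           end].

Record graph := Graph {
  vtx : finType;
  edg : finType;
  src : edg -> vtx;
  tgt : edg -> vtx }.

Definition graph_empty : graph :=
  @Graph void void (fun e => e) (fun e => e).

Definition graph_sum (G H : graph) : graph :=
  @Graph (vtx G + vtx H)%type (edg G + edg H)%type
    (fun e => match e with inl e1 => inl (src e1) | inr e2 => inr (src e2) end)
    (fun e => match e with inl e1 => inl (tgt e1) | inr e2 => inr (tgt e2) end).

Definition is_empty_graph (G : graph) : Prop := #|vtx G| = 0 /\ #|edg G| = 0.

Record giso (G H : graph) := GIso {
  isoV : vtx G -> vtx H;
  isoE : edg G -> edg H;
  isoV_bij : bijective isoV;
  isoE_bij : bijective isoE;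
  iso_src : forall e, src (isoE e) = isoV (src e);
  iso_tgt : forall e, tgt (isoE e) = isoV (tgt e) }.

(* A decomposition of [G] into a disjoint union of [n] numbered graphs. *)
Record decomposition (G : graph) (n : nat) := Decomposition {
  numV : vtx G -> 'I_n;
  numE : edg G -> 'I_n;
  num_src : forall e, numV (src e) = numE e;
  num_tgt : forall e, numV (tgt e) = numE e }.

Section Part.
Variables (G : graph) (n : nat) (c : decomposition G n) (i : 'I_n).

Lemma part_src (e : {e : edg G | numE c e == i}) : numV c (src (val e)) == i.
Proof. by rewrite num_src; exact: valP e. Qed.

Lemma part_tgt (e : {e : edg G | numE c e == i}) : numV c (tgt (val e)) == i.
Proof. by rewrite num_tgt; exact: valP e. Qed.

Definition part : graph :=
  @Graph {v : vtx G | numV c v == i} {e : edg G | numE c e == i}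
    (fun e => Sub (src (val e)) (part_src e))
    (fun e => Sub (tgt (val e)) (part_tgt e)).
End Part.

(* A pair of relations between two graphs, one on vertices and one on edges;
   it is a linear rule [lhs -> rhs] if [linear_rule] holds. *)
Record prerule := Prerule {
  lhs : graph;
  rhs : graph;
  relV : {set vtx lhs * vtx rhs};
  relE : {set edg lhs * edg rhs} }.

Record linear_rule (R : prerule) : Prop := LinearRule {
  relV_one_to_one : one_to_one (relV R);
  relE_one_to_one : one_to_one (relE R);
  rel_src_tgt : forall e e', (e, e') \in relE R ->
    (src e, src e') \in relV R /\ (tgt e, tgt e') \in relV R }.

Definition is_empty_rule (R : prerule) : Prop :=
  is_empty_graph (lhs R) /\ is_empty_graph (rhs R).

Definition rule_sum (R S : prerule) : prerule :=
  @Prerule (graph_sum (lhs R) (lhs S)) (graph_sum (rhs R) (rhs S))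
    (rel_sum (relV R) (relV S)) (rel_sum (relE R) (relE S)).

Definition rule_iso (R S : prerule) : Prop :=
  exists (i : giso (lhs R) (lhs S)) (o : giso (rhs R) (rhs S)),
    relV S = rel_image (isoV i) (isoV o) (relV R) /\
    relE S = rel_image (isoE i) (isoE o) (relE R).

Definition connected_rule (R : prerule) : Prop :=
  [/\ linear_rule R, ~ is_empty_rule R &
      forall R1 R2 : prerule, linear_rule R1 -> linear_rule R2 ->
        rule_iso R (rule_sum R1 R2) -> is_empty_rule R1 \/ is_empty_rule R2].

(* The restriction of [R] to the [i]-th summands of its two graphs. *)
Definition constituent (R : prerule) (n : nat) (cI : decomposition (lhs R) n)
    (cO : decomposition (rhs R) n) (i : 'I_n) : prerule :=
  @Prerule (part cI i) (part cO i)
    [set p | (val p.1, val p.2) \in relV R]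
    [set p | (val p.1, val p.2) \in relE R].

(* The data [(I, O, r, m, s, t)] of a rule diagram, without its axioms; [I], [O]
   and [r] are those of the underlying prerule. *)
Record prediagram := Prediagram {
  rule_of :> prerule;
  matV : {set vtx (rhs rule_of) * vtx (lhs rule_of)};
  matE : {set edg (rhs rule_of) * edg (lhs rule_of)} }.

(* The underlying rule is the disjoint union of numbered connected linear rules
   [r_i], and [m] relates outputs of [r_j] to inputs of [r_i] only if [i < j].
   The numbering is quantified existentially, hence not part of the data. *)
Definition has_constituents (X : prediagram) : Prop :=
  exists (n : nat) (cI : decomposition (lhs X) n)
         (cO : decomposition (rhs X) n),
  [/\ (forall x y, (x, y) \in relV X -> numV cI x = numV cO y)
        /\ (forall x y, (x, y) \in relE X -> numE cI x = numE cO y),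
      forall i, connected_rule (constituent cI cO i),
      forall y x, (y, x) \in matV X -> (numV cI x < numV cO y)%N
    & forall y x, (y, x) \in matE X -> (numE cI x < numE cO y)%N].

Record is_rule_diagram (X : prediagram) : Prop := IsRuleDiagram {
  rd_constituents : has_constituents X;
  matV_one_to_one : one_to_one (matV X);
  matE_one_to_one : one_to_one (matE X);
  omega_src_tgt : forall e e', (e, e') \in omega (matE X) (relE X) ->
    (src e, src e') \in omega (matV X) (relV X) /\
    (tgt e, tgt e') \in omega (matV X) (relV X) }.

Record rule_diagram := RuleDiagram {
  rd_val :> prediagram;
  rd_axioms : is_rule_diagram rd_val }.

Definition diagram_iso (X Y : prediagram) : Prop :=
  exists (i : giso (lhs X) (lhs Y)) (o : giso (rhs X) (rhs Y)),
    [/\ relV Y = rel_image (isoV i) (isoV o) (relV X),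
        relE Y = rel_image (isoE i) (isoE o) (relE X),
        matV Y = rel_image (isoV o) (isoV i) (matV X) &
        matE Y = rel_image (isoE o) (isoE i) (matE X)].

Definition diagram_sum (X Y : prediagram) : prediagram :=
  @Prediagram (rule_sum X Y)
    (rel_sum (matV X) (matV Y)) (rel_sum (matE X) (matE Y)).

Definition diagram_empty : prediagram :=
  @Prediagram (@Prerule graph_empty graph_empty set0 set0) set0 set0.

(* The tuple occurring in the composition of [A] and [B]: the outputs of [B]
   are matched with the inputs of [A] along [m]. *)
Definition diagram_glue (A B : prediagram)
    (m : {set vtx (rhs B) * vtx (lhs A)} * {set edg (rhs B) * edg (lhs A)}) :
    prediagram :=
  @Prediagram (rule_sum A B)
    (rel_glue (matV A) m.1 (matV B)) (rel_glue (matE A) m.2 (matE B)).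

Section RelationLemmas.
Implicit Types A B C D : finType.

Lemma rel_imageP A B C D (f : A -> C) (g : B -> D) (R : {set A * B}) c d :
  reflect (exists a b, [/\ (a, b) \in R, c = f a & d = g b])
          ((c, d) \in rel_image f g R).
Proof.
apply: (iffP imsetP) => [[[a b] Rab [-> ->]]|[a [b [Rab -> ->]]]].
  by exists a, b.
by exists (a, b).
Qed.

Lemma mem_rel_image A B C D (f : A -> C) (g : B -> D) (R : {set A * B}) a b :
  injective f -> injective g ->
  ((f a, g b) \in rel_image f g R) = ((a, b) \in R).
Proof.
move=> fI gI; apply/rel_imageP/idP => [[a' [b' [Rab /fI -> /gI ->]]] //|Rab].
by exists a, b.
Qed.

Lemma rel_image_id A B (R : {set A * B}) : rel_image id id R = R.
Proof.
apply/setP => -[a b]; apply/rel_imageP/idP => [[? [? [? -> ->]]] //|Rab].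
by exists a, b.
Qed.

Lemma rel_image_comp A B C D (E F : finType) (f : A -> C) (g : B -> D) (f' : C -> E)
    (g' : D -> F) (R : {set A * B}) :
  rel_image f' g' (rel_image f g R) = rel_image (f' \o f) (g' \o g) R.
Proof. by rewrite /rel_image -imset_comp. Qed.

Lemma eq_rel_image A B C D (f f' : A -> C) (g g' : B -> D) (R : {set A * B}) :
  f =1 f' -> g =1 g' -> rel_image f g R = rel_image f' g' R.
Proof. by move=> ef eg; apply: eq_imset => p; rewrite ef eg. Qed.

Lemma rel_image_can A B C D (f : A -> C) (g : B -> D) f' g' (R : {set A * B}) :
  cancel f f' -> cancel g g' -> R = rel_image f' g' (rel_image f g R).
Proof.
move=> fK gK; rewrite rel_image_comp -[LHS]rel_image_id.
by apply: eq_rel_image => x /=; rewrite ?fK ?gK.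
Qed.

Lemma one_to_one_image A B C D (f : A -> C) (g : B -> D) (R : {set A * B}) :
  injective f -> injective g -> one_to_one R -> one_to_one (rel_image f g R).
Proof.
move=> fI gI RR [c d] [c' d'] /rel_imageP[a [b [Rab -> ->]]].
case/rel_imageP=> a' [b' [Rab' -> ->]] /= ne.
have /(RR _ _ Rab Rab')/= [n1 n2] : (a, b) <> (a', b').
  by case=> ? ?; apply: ne; subst.
by split=> [/fI|/gI].
Qed.

Lemma connect_homo A B (e : rel A) (e' : rel B) (f : A -> B) :
  (forall x y, e x y -> e' (f x) (f y)) ->
  forall x y, connect e x y -> connect e' (f x) (f y).
Proof.
move=> he x y /connectP[p]; elim: p x => [x _ -> //|z p IHp x /= /andP[exz pp] ly].
by apply: connect_trans (connect1 (he _ _ exz)) (IHp _ pp ly).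
Qed.

Lemma omega_image A B C D (f : A -> C) (g : B -> D)
    (m : {set A * B}) (r : {set B * A}) a b : bijective f -> bijective g ->
  ((f a, g b) \in omega (rel_image f g m) (rel_image g f r))
    = ((a, b) \in omega m r).
Proof.
move=> [f' fK f'K] [g' gK g'K].
have fI := can_inj fK; have gI := can_inj gK.
have step x y : ((f x, f y) \in rel_comp (rel_image g f r) (rel_image f g m))
    = ((x, y) \in rel_comp r m).
  rewrite !inE /=; apply/existsP/existsP => -[z].
    by rewrite -[z]g'K !mem_rel_image //; exists (g' z).
  by exists (g z); rewrite !mem_rel_image.
rewrite !inE /=; apply/existsP/existsP => -[z]; rewrite !inE /=.
  rewrite -[z]f'K mem_rel_image // => /andP[cz mz].
  exists (f' z); rewrite inE /= mz andbT.
  rewrite -[a]fK -[f' z]fK; apply: (connect_homo (f := f')) cz => x y /=.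
  by rewrite -{1}[x]f'K -{1}[y]f'K step.
move=> /andP[cz mz]; exists (f z); rewrite inE /= mem_rel_image // mz andbT.
by apply: connect_homo cz => x y /=; rewrite step.
Qed.

Lemma one_to_one_sum A B C D (R : {set A * C}) (S : {set B * D}) :
  one_to_one R -> one_to_one S -> one_to_one (rel_sum R S).
Proof.
move=> RR SS [[a|b] [c|d]] [[a'|b'] [c'|d']]; rewrite !inE //= => h h' ne.
  have /(RR _ _ h h')/= [n1 n2] : (a, c) <> (a', c').
    by case=> ? ?; apply: ne; subst.
  by split=> -[].
have /(SS _ _ h h')/= [n1 n2] : (b, d) <> (b', d').
  by case=> ? ?; apply: ne; subst.
by split=> -[].
Qed.

Lemma omega_sum A B C D (m : {set A * C}) (m' : {set B * D})
    (r : {set C * A}) (r' : {set D * B}) :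
  omega (rel_sum m m') (rel_sum r r') = rel_sum (omega m r) (omega m' r').
Proof.
pose E := fun x y => (x, y) \in rel_comp (rel_sum r r') (rel_sum m m').
have stepl x y : E (inl x) (inl y) = ((x, y) \in rel_comp r m).
  rewrite /E !inE /=; apply/existsP/existsP => [[[z|z]]|[z]]; rewrite ?inE //.
    by exists z.
  by exists (inl z); rewrite !inE.
have stepr x y : E (inr x) (inr y) = ((x, y) \in rel_comp r' m').
  rewrite /E !inE /=; apply/existsP/existsP => [[[z|z]]|[z]]; rewrite ?inE //.
    by exists z.
  by exists (inr z); rewrite !inE.
have steplr x y : E (inl x) (inr y) = false.
  by rewrite /E !inE /=; apply/existsP => -[[z|z]]; rewrite !inE ?andbF.
have steprl x y : E (inr x) (inl y) = false.
  by rewrite /E !inE /=; apply/existsP => -[[z|z]]; rewrite !inE ?andbF.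
have cl x w : connect E (inl x) w ->
    exists2 y, w = inl y & connect (fun x y => (x, y) \in rel_comp r m) x y.
  case/connectP=> p; elim: p x => [x _ -> /=|[z|z] p IHp x] /=; first by exists x.
    rewrite stepl => /andP[xz pp] /(IHp _ pp)[y -> zy]; exists y => //.
    exact: connect_trans (connect1 _) zy.
  by rewrite steplr.
have cr x w : connect E (inr x) w ->
    exists2 y, w = inr y & connect (fun x y => (x, y) \in rel_comp r' m') x y.
  case/connectP=> p; elim: p x => [x _ -> /=|[z|z] p IHp x] /=; first by exists x.
    by rewrite steprl.
  rewrite stepr => /andP[xz pp] /(IHp _ pp)[y -> zy]; exists y => //.
  exact: connect_trans (connect1 _) zy.
apply/setP => -[a b]; rewrite !inE /=; apply/existsP/idP.
  case=> w; rewrite inE /=; case: a => a /andP[cw]; [case: (cl _ _ cw)|case: (cr _ _ cw)];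
    move=> z ->; case: b => b; rewrite !inE //= => az mz; apply/existsP;
    by exists z; rewrite inE /= az.
case: a b => a [] b //; rewrite !inE /= => /existsP[z]; rewrite inE /= => /andP[cz mz].
  exists (inl z); rewrite !inE /= mz andbT.
  by apply: (connect_homo (f := inl)) cz => x y; rewrite -stepl.
exists (inr z); rewrite !inE /= mz andbT.
by apply: (connect_homo (f := inr)) cz => x y; rewrite -stepr.
Qed.

Lemma mem_rel_sum A B C D (R : {set A * C}) (S : {set B * D}) p :
  (p \in rel_sum R S) = match p with
                        | (inl a, inl c) => (a, c) \in R
                        | (inr b, inr d) => (b, d) \in S
                        | _ => false
                        end.
Proof. by rewrite inE. Qed.

Lemma rel_image_sum A A' B B' C C' D D' (f : A -> A') (g : B -> B')
    (h : C -> C') (k : D -> D') (R : {set A * C}) (S : {set B * D}) :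
  rel_sum (rel_image f h R) (rel_image g k S) =
  rel_image (fun x => match x with inl a => inl (f a) | inr b => inr (g b) end)
            (fun x => match x with inl c => inl (h c) | inr d => inr (k d) end)
            (rel_sum R S).
Proof.
apply/setP => -[x y]; apply/idP/rel_imageP => [|[[a|b] [[c|d] [+ -> ->]]]];
    rewrite ?inE //.
- case: x y => x [] y //; case/rel_imageP=> a [c [Rac -> ->]].
    by exists (inl a), (inl c); rewrite inE.
  by exists (inr a), (inr c); rewrite inE.
- by move=> Rac; apply/rel_imageP; exists a, c.
- by move=> Rac; apply/rel_imageP; exists b, d.
Qed.

End RelationLemmas.

Section IsoLemmas.

Definition giso_id (G : graph) : giso G G :=
  @GIso G G id id (Bijective (frefl _) (frefl _)) (Bijective (frefl _) (frefl _))
    (fun=> erefl) (fun=> erefl).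

Definition giso_comp (G H K : graph) (j : giso H K) (i : giso G H) : giso G K.
Proof.
refine (@GIso G K (isoV j \o isoV i) (isoE j \o isoE i) _ _ _ _).
- exact: bij_comp (isoV_bij j) (isoV_bij i).
- exact: bij_comp (isoE_bij j) (isoE_bij i).
- by move=> e /=; rewrite !iso_src.
- by move=> e /=; rewrite !iso_tgt.
Defined.

Lemma giso_inv (G H : graph) (i : giso G H) :
  exists j : giso H G, [/\ cancel (isoV i) (isoV j), cancel (isoV j) (isoV i),
                           cancel (isoE i) (isoE j) & cancel (isoE j) (isoE i)].
Proof.
case: i => f g [f' fK f'K] [g' gK g'K] hs ht.
unshelve eexists (@GIso H G f' g' (Bijective f'K fK) (Bijective g'K gK) _ _).
- by move=> e; apply: (can_inj fK); rewrite -hs f'K g'K.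
- by move=> e; apply: (can_inj fK); rewrite -ht f'K g'K.
by split.
Qed.

Definition giso_sum (G G' H H' : graph) (i : giso G G') (j : giso H H') :
  giso (graph_sum G H) (graph_sum G' H').
Proof.
refine (@GIso (graph_sum G H) (graph_sum G' H')
  (fun x => match x with inl a => inl (isoV i a) | inr b => inr (isoV j b) end)
  (fun x => match x with inl a => inl (isoE i a) | inr b => inr (isoE j b) end)
  _ _ _ _).
- case: (isoV_bij i) (isoV_bij j) => f fK f'K [g gK g'K].
  exists (fun x => match x with inl a => inl (f a) | inr b => inr (g b) end);
  by case=> x; rewrite ?fK ?f'K ?gK ?g'K.
- case: (isoE_bij i) (isoE_bij j) => f fK f'K [g gK g'K].
  exists (fun x => match x with inl a => inl (f a) | inr b => inr (g b) end);
  by case=> x; rewrite ?fK ?f'K ?gK ?g'K.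
- by case=> e /=; rewrite iso_src.
- by case=> e /=; rewrite iso_tgt.
Defined.

Lemma giso_empty (G H : graph) (i : giso G H) :
  is_empty_graph G -> is_empty_graph H.
Proof.
by case=> hv he; split; [rewrite -(bij_eq_card (isoV_bij i))|
  rewrite -(bij_eq_card (isoE_bij i))].
Qed.

Lemma diagram_iso_refl X : diagram_iso X X.
Proof.
by exists (giso_id _), (giso_id _); split; rewrite /= rel_image_id.
Qed.

Lemma diagram_iso_sym X Y : diagram_iso X Y -> diagram_iso Y X.
Proof.
case=> i [o [eV eE mV mE]].
have [i' [iK _ iK' _]] := giso_inv i; have [o' [oK _ oK' _]] := giso_inv o.
by exists i', o'; rewrite eV eE mV mE; split; apply: rel_image_can.
Qed.

Lemma diagram_iso_trans X Y Z :
  diagram_iso X Y -> diagram_iso Y Z -> diagram_iso X Z.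
Proof.
case=> i [o [eV eE mV mE]] [i' [o' [eV' eE' mV' mE']]].
exists (giso_comp i' i), (giso_comp o' o).
by split; rewrite /= -rel_image_comp -?eV -?eE -?mV -?mE.
Qed.

Lemma rule_iso_sym X Y : rule_iso X Y -> rule_iso Y X.
Proof.
case=> i [o [eV eE]].
have [i' [iK _ iK' _]] := giso_inv i; have [o' [oK _ oK' _]] := giso_inv o.
by exists i', o'; rewrite eV eE; split; apply: rel_image_can.
Qed.

Lemma rule_iso_trans X Y Z : rule_iso X Y -> rule_iso Y Z -> rule_iso X Z.
Proof.
case=> i [o [eV eE]] [i' [o' [eV' eE']]].
exists (giso_comp i' i), (giso_comp o' o).
by split; rewrite /= -rel_image_comp -?eV -?eE.
Qed.

Lemma linear_rule_iso R S : rule_iso R S -> linear_rule R -> linear_rule S.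
Proof.
case=> i [o [eV eE]] [oV oE hst].
have bi := (bij_inj (isoV_bij i), bij_inj (isoE_bij i)).
have bo := (bij_inj (isoV_bij o), bij_inj (isoE_bij o)).
split; rewrite ?eV ?eE.
- exact: one_to_one_image bi.1 bo.1 oV.
- exact: one_to_one_image bi.2 bo.2 oE.
- move=> e e' /rel_imageP[a [b [/hst [hs ht] -> ->]]].
  rewrite !iso_src !iso_tgt !mem_rel_image; try by [exact: bi.1|exact: bo.1].
  by split.
Qed.

Lemma connected_rule_iso R S :
  rule_iso R S -> connected_rule R -> connected_rule S.
Proof.
move=> iRS [lR nR cR]; split; first exact: linear_rule_iso iRS lR.
  case: iRS => i [o _] [eI eO]; apply: nR.
  have [i' _] := giso_inv i; have [o' _] := giso_inv o.
  by split; [apply: giso_empty eI|apply: giso_empty eO].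
move=> R1 R2 l1 l2 iS; apply: cR l1 l2 _; exact: rule_iso_trans iRS iS.
Qed.

(* Isomorphic rules with corresponding decompositions have isomorphic
   constituents; the maps [f] and [g] renumber the constituents. *)
Section Constituents.
Variables (R S : prerule) (n k : nat).
Variables (cI : decomposition (lhs R) n) (cO : decomposition (rhs R) n).
Variables (dI : decomposition (lhs S) k) (dO : decomposition (rhs S) k).
Variables (a : 'I_n) (b : 'I_k).
Variables (iV : vtx (lhs R) -> vtx (lhs S)) (iE : edg (lhs R) -> edg (lhs S)).
Variables (oV : vtx (rhs R) -> vtx (rhs S)) (oE : edg (rhs R) -> edg (rhs S)).
Hypotheses (iV_inj : injective iV) (iE_inj : injective iE)
           (oV_inj : injective oV) (oE_inj : injective oE).
Hypothesis iVn : forall v, (numV dI (iV v) == b) = (numV cI v == a).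
Hypothesis iEn : forall v, (numE dI (iE v) == b) = (numE cI v == a).
Hypothesis oVn : forall v, (numV dO (oV v) == b) = (numV cO v == a).
Hypothesis oEn : forall v, (numE dO (oE v) == b) = (numE cO v == a).
Hypothesis iVs : forall w, numV dI w == b -> exists v, w = iV v.
Hypothesis iEs : forall w, numE dI w == b -> exists v, w = iE v.
Hypothesis oVs : forall w, numV dO w == b -> exists v, w = oV v.
Hypothesis oEs : forall w, numE dO w == b -> exists v, w = oE v.
Hypothesis i_src : forall e, src (iE e) = iV (src e).
Hypothesis i_tgt : forall e, tgt (iE e) = iV (tgt e).
Hypothesis o_src : forall e, src (oE e) = oV (src e).
Hypothesis o_tgt : forall e, tgt (oE e) = oV (tgt e).
Hypothesis rV : forall x y, ((iV x, oV y) \in relV S) = ((x, y) \in relV R).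
Hypothesis rE : forall x y, ((iE x, oE y) \in relE S) = ((x, y) \in relE R).

Let sub_map (A B : finType) (P : pred A) (Q : pred B) (f : A -> B)
  (h : forall v, Q (f v) = P v) (u : {v | P v}) : {w | Q w} :=
  exist _ (f (val u)) (etrans (h (val u)) (valP u)).

Let sub_map_bij (A B : finType) (P : pred A) (Q : pred B) (f : A -> B)
    (h : forall v, Q (f v) = P v) :
  injective f -> (forall w, Q w -> exists v, w = f v) -> bijective (sub_map h).
Proof.
move=> fI fs; apply: inj_card_bij; last first.
  rewrite -(card_imset _ (inj_comp fI val_inj)) -[leqLHS](card_imset _ val_inj).
  apply/subset_leq_card/subsetP => _ /imsetP[[w Qw] _ ->] /=.
  have [v ev] := fs _ Qw; have Pv : P v by rewrite -h -ev.
  by apply/imsetP; exists (exist _ v Pv).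
by move=> u v /(congr1 val)/fI/val_inj.
Qed.

Lemma constituent_iso : rule_iso (constituent cI cO a) (constituent dI dO b).
Proof.
have bIV := sub_map_bij iVn iV_inj iVs.
have bIE := sub_map_bij iEn iE_inj iEs.
have bOV := sub_map_bij oVn oV_inj oVs.
have bOE := sub_map_bij oEn oE_inj oEs.
unshelve eexists (@GIso (part cI a) (part dI b) _ _ bIV bIE _ _);
  [by move=> e; apply: val_inj => /=; rewrite ?i_src ?i_tgt..|].
unshelve eexists (@GIso (part cO a) (part dO b) _ _ bOV bOE _ _);
  [by move=> e; apply: val_inj => /=; rewrite ?o_src ?o_tgt..|].
split; apply/setP => -[x y] /=.
  have [fx _ fxK] := bIV; have [fy _ fyK] := bOV.
  rewrite -[x]fxK -[y]fyK mem_rel_image ?inE /= ?rV //; exact: bij_inj.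
have [fx _ fxK] := bIE; have [fy _ fyK] := bOE.
rewrite -[x]fxK -[y]fyK mem_rel_image ?inE /= ?rE //; exact: bij_inj.
Qed.
End Constituents.

Lemma is_rule_diagram_iso X Y :
  diagram_iso X Y -> is_rule_diagram X -> is_rule_diagram Y.
Proof.
case=> i [o [eV eE mV mE]] [[n [cI [cO [[hV hE] hc hmV hmE]]]] oV oE hom].
have bi := (bij_inj (isoV_bij i), bij_inj (isoE_bij i)).
have bo := (bij_inj (isoV_bij o), bij_inj (isoE_bij o)).
split; last first.
- move=> e e'; have [gi _ giK] := isoE_bij i; have [go _ goK] := isoE_bij o.
  rewrite -[e]goK -[e']giK eE mE omega_image; [|exact: isoE_bij..].
  move=> /hom[hs ht]; rewrite !(iso_src i, iso_src o, iso_tgt i, iso_tgt o).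
  rewrite eV mV; split.
    by rewrite (omega_image _ _ _ _ (isoV_bij o) (isoV_bij i)).
  by rewrite (omega_image _ _ _ _ (isoV_bij o) (isoV_bij i)).
- by rewrite mE; apply: one_to_one_image bo.2 bi.2 oE.
- by rewrite mV; apply: one_to_one_image bo.1 bi.1 oV.
have [i' [iK i'K iK' i'K']] := giso_inv i.
have [o' [oK o'K oK' o'K']] := giso_inv o.
unshelve eexists n, (@Decomposition (lhs Y) n (numV cI \o isoV i')
  (numE cI \o isoE i') _ _), (@Decomposition (rhs Y) n (numV cO \o isoV o')
  (numE cO \o isoE o') _ _);
  [by move=> e /=; rewrite -?iso_src -?iso_tgt ?num_src ?num_tgt..|].
split=> /=.
- split=> x y; rewrite ?eV ?eE => /rel_imageP[a [b [rab -> ->]]].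
    by rewrite iK oK; exact: hV.
  by rewrite iK' oK'; exact: hE.
- move=> a; apply: connected_rule_iso (hc a).
  apply: (@constituent_iso X Y n n cI cO _ _ a a (isoV i) (isoE i) (isoV o)
    (isoE o)) => //=; try by [exact: bi.1|exact: bi.2|exact: bo.1|exact: bo.2|
      exact: iso_src|exact: iso_tgt].
  + by move=> v; rewrite iK.
  + by move=> v; rewrite iK'.
  + by move=> v; rewrite oK.
  + by move=> v; rewrite oK'.
  + by move=> w _; exists (isoV i' w).
  + by move=> w _; exists (isoE i' w).
  + by move=> w _; exists (isoV o' w).
  + by move=> w _; exists (isoE o' w).
  + by move=> x y; rewrite eV mem_rel_image //; [exact: bi.1|exact: bo.1].
  + by move=> x y; rewrite eE mem_rel_image //; [exact: bi.2|exact: bo.2].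
- move=> y x; rewrite mV => /rel_imageP[a [b [rab -> ->]]].
  by rewrite iK oK; exact: hmV.
- move=> y x; rewrite mE => /rel_imageP[a [b [rab -> ->]]].
  by rewrite iK' oK'; exact: hmE.
Qed.

Lemma is_rule_diagram_empty : is_rule_diagram diagram_empty.
Proof.
split=> [|p q|p q|[]]; rewrite ?inE //.
unshelve eexists 0, (@Decomposition graph_empty 0 _ _ _ _),
  (@Decomposition graph_empty 0 _ _ _ _); try by case.
by split=> [|[]//|[]//|[]//]; split=> -[].
Qed.

Definition sum_decomposition (G H : graph) (n k : nat) (c : decomposition G n)
  (d : decomposition H k) : decomposition (graph_sum G H) (n + k).
Proof.
refine (@Decomposition (graph_sum G H) (n + k)
  (fun x => match x with inl a => lshift k (numV c a)
                       | inr b => rshift n (numV d b) end)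
  (fun x => match x with inl a => lshift k (numE c a)
                       | inr b => rshift n (numE d b) end) _ _).
- by case=> e /=; rewrite num_src.
- by case=> e /=; rewrite num_tgt.
Defined.

Lemma is_rule_diagram_sum X Y : is_rule_diagram X -> is_rule_diagram Y ->
  is_rule_diagram (diagram_sum X Y).
Proof.
case=> [[n [cI [cO [[hV hE] hc hmV hmE]]]] oV oE hom].
case=> [[k [dI [dO [[hV' hE'] hc' hmV' hmE']]]] oV' oE' hom'].
split=> /=; try exact: one_to_one_sum; last first.
  move=> e e'; rewrite !omega_sum !mem_rel_sum.
  by case: e e' => e [] e' //=; [exact: hom|exact: hom'].
exists (n + k), (sum_decomposition cI dI), (sum_decomposition cO dO).
split=> /=.
- split=> -[x|x] [y|y]; rewrite inE //=.
  + by move/hV->. + by move/hV'->.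
  + by move/hE->. + by move/hE'->.
- move=> a; case: (split_ordP a) => b ->.
    apply: connected_rule_iso (hc b).
    by apply: (@constituent_iso X (rule_sum X Y) _ _ cI cO _ _ b (lshift k b)
       inl inl inl inl) => //=;
      first [exact: inl_inj | move=> v; rewrite eq_lshift |
        move=> [w|w]; rewrite ?eq_rlshift // => _; exists w |
        move=> x y; rewrite inE].
  apply: connected_rule_iso (hc' b).
  by apply: (@constituent_iso Y (rule_sum X Y) _ _ dI dO _ _ b (rshift n b)
     inr inr inr inr) => //=;
    first [exact: inr_inj | move=> v; rewrite eq_rshift |
      move=> [w|w]; rewrite ?eq_lrshift // => _; exists w |
      move=> x y; rewrite inE].
- move=> [y|y] [x|x]; rewrite inE //=; first exact: hmV.
  by rewrite ltn_add2l; exact: hmV'.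
- move=> [y|y] [x|x]; rewrite inE //=; first exact: hmE.
  by rewrite ltn_add2l; exact: hmE'.
Qed.

End IsoLemmas.

Definition rd_empty : rule_diagram := RuleDiagram is_rule_diagram_empty.

Definition rd_sum (X Y : rule_diagram) : rule_diagram :=
  RuleDiagram (is_rule_diagram_sum (rd_axioms X) (rd_axioms Y)).

Definition primitive (X : rule_diagram) : Prop :=
  ~ is_empty_rule X /\
  forall X1 X2 : rule_diagram, diagram_iso X (rd_sum X1 X2) ->
    is_empty_rule X1 \/ is_empty_rule X2.

(* Isomorphism classes.  [rule_diagram] quantifies over all finite types and
   is too large to carry a [choiceType] structure, so the quotient is taken on
   the rule diagrams whose vertices and edges are ordinals; [std] shows that
   every rule diagram is isomorphic to one of these. *)

Record sgraph := SGraph {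
  snv : nat;
  sne : nat;
  ssrc : 'I_sne -> 'I_snv;
  stgt : 'I_sne -> 'I_snv }.

Definition graph_of (G : sgraph) : graph :=
  @Graph 'I_(snv G) 'I_(sne G) (@ssrc G) (@stgt G).

Record sdiagram := SDiagram {
  slhs : sgraph;
  srhs : sgraph;
  srelV : {set vtx (graph_of slhs) * vtx (graph_of srhs)};
  srelE : {set edg (graph_of slhs) * edg (graph_of srhs)};
  smatV : {set vtx (graph_of srhs) * vtx (graph_of slhs)};
  smatE : {set edg (graph_of srhs) * edg (graph_of slhs)};
  s_axioms : is_rule_diagram (Prediagram (rule_of := Prerule srelV srelE)
                                smatV smatE) }.

HB.instance Definition _ := gen_eqMixin sdiagram.
HB.instance Definition _ := gen_choiceMixin sdiagram.

Definition rd_of (X : sdiagram) : rule_diagram := RuleDiagram (s_axioms X).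

Definition std_graph (G : graph) : sgraph :=
  @SGraph #|vtx G| #|edg G| (fun e => enum_rank (src (enum_val e)))
    (fun e => enum_rank (tgt (enum_val e))).

Definition std_giso (G : graph) : giso G (graph_of (std_graph G)).
Proof.
refine (@GIso G (graph_of (std_graph G)) enum_rank enum_rank _ _ _ _).
- exact: enum_rank_bij.
- exact: enum_rank_bij.
- by move=> e /=; rewrite enum_rankK.
- by move=> e /=; rewrite enum_rankK.
Defined.

Definition std_prediagram (X : prediagram) : prediagram :=
  let i := std_giso (lhs X) in
  let o := std_giso (rhs X) in
  @Prediagram (@Prerule (graph_of (std_graph (lhs X)))
                        (graph_of (std_graph (rhs X)))
                 (rel_image (isoV i) (isoV o) (relV X))
                 (rel_image (isoE i) (isoE o) (relE X)))
    (rel_image (isoV o) (isoV i) (matV X))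
    (rel_image (isoE o) (isoE i) (matE X)).

Lemma std_iso (X : prediagram) : diagram_iso X (std_prediagram X).
Proof. by exists (std_giso _), (std_giso _). Qed.

Definition std (X : rule_diagram) : sdiagram :=
  SDiagram (is_rule_diagram_iso (std_iso X) (rd_axioms X)).

Definition siso (X Y : sdiagram) : bool := `[< diagram_iso (rd_of X) (rd_of Y) >].

Lemma siso_equiv : equiv_class_of siso.
Proof.
split.
- by move=> X; apply/asboolP; exact: diagram_iso_refl.
- by move=> X Y; apply/asboolP/asboolP; exact: diagram_iso_sym.
- move=> Y X Z /asboolP XY /asboolP YZ; apply/asboolP.
  exact: diagram_iso_trans XY YZ.
Qed.

Canonical siso_equivRel := EquivRelPack siso_equiv.

Definition diagram_class := {eq_quot siso}%qT.
HB.instance Definition _ := Choice.on diagram_class.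
HB.instance Definition _ := EqQuotient.on diagram_class.

Definition class_of (X : rule_diagram) : diagram_class :=
  (\pi_diagram_class (std X))%qT.

Definition rep (c : diagram_class) : rule_diagram := rd_of (repr c).

Lemma class_of_eq (X Y : rule_diagram) :
  class_of X = class_of Y <-> diagram_iso X Y.
Proof.
have sX := std_iso X; have sY := std_iso Y; split.
  move/eqquotP/asboolP => XY; apply: diagram_iso_trans sX _.
  exact: diagram_iso_trans XY (diagram_iso_sym sY).
move=> XY; apply/eqquotP/asboolP.
exact: diagram_iso_trans (diagram_iso_sym sX) (diagram_iso_trans XY sY).
Qed.

Lemma class_of_rep (c : diagram_class) : class_of (rep c) = c.
Proof.
rewrite -[RHS]reprK; apply/eqquotP/asboolP.
exact/diagram_iso_sym/std_iso.
Qed.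

Definition class_empty : diagram_class := class_of rd_empty.

Definition class_union (c1 c2 : diagram_class) : diagram_class :=
  class_of (rd_sum (rep c1) (rep c2)).

Lemma class_unionE (X Y : rule_diagram) :
  class_union (class_of X) (class_of Y) = class_of (rd_sum X Y).
Proof.
apply/class_of_eq.
have /class_of_eq[i [o [eV eE mV mE]]] := class_of_rep (class_of X).
have /class_of_eq[i' [o' [eV' eE' mV' mE']]] := class_of_rep (class_of Y).
exists (giso_sum i i'), (giso_sum o o').
by split; rewrite /= -rel_image_sum -?eV -?eE -?mV -?mE -?eV' -?eE' -?mV' -?mE'.
Qed.

Definition primitive_class : Type :=
  {c : diagram_class | `[< primitive (rep c) >]}.
HB.instance Definition _ := Choice.on primitive_class.

Section UnionLemmas.

Let sum_assoc (A B C : finType) (x : A + (B + C)) : A + B + C :=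
  match x with
  | inl a => inl (inl a)
  | inr (inl b) => inl (inr b)
  | inr (inr c) => inr c
  end.

Let sum_assoc_bij A B C : bijective (@sum_assoc A B C).
Proof.
by exists (fun x => match x with inl (inl a) => inl a
  | inl (inr b) => inr (inl b) | inr c => inr (inr c) end); do 3 ?case.
Qed.

Let giso_assoc (G H L : graph) :
  giso (graph_sum G (graph_sum H L)) (graph_sum (graph_sum G H) L).
Proof.
refine (@GIso (graph_sum G (graph_sum H L)) (graph_sum (graph_sum G H) L)
  (@sum_assoc _ _ _) (@sum_assoc _ _ _) (sum_assoc_bij _ _ _)
  (sum_assoc_bij _ _ _) _ _); by case=> [?|[?|?]].
Defined.

Lemma class_unionA : associative class_union.
Proof.
move=> a b c; rewrite -(class_of_rep a) -(class_of_rep b) -(class_of_rep c).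
move: (rep a) (rep b) (rep c) => {a b c} X Y Z; rewrite !class_unionE.
apply/class_of_eq.
have sr (A B C D E F : finType) (R : {set A * B}) (S : {set C * D})
    (T : {set E * F}) : rel_sum (rel_sum R S) T =
    rel_image (@sum_assoc _ _ _) (@sum_assoc _ _ _) (rel_sum R (rel_sum S T)).
  apply/setP => -[x y].
  have [s1 _ s1K] := sum_assoc_bij A C E; have [s2 _ s2K] := sum_assoc_bij B D F.
  rewrite -[x]s1K -[y]s2K mem_rel_image; try exact/bij_inj/sum_assoc_bij.
  move: (s1 x) (s2 y).
  by case=> [u|[u|u]] [v|[v|v]]; rewrite !mem_rel_sum /= ?mem_rel_sum.
by exists (giso_assoc _ _ _), (giso_assoc _ _ _); split; exact: sr.
Qed.

Let giso_empty_sum (G : graph) : giso G (graph_sum graph_empty G).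
Proof.
refine (@GIso G (graph_sum graph_empty G) inr inr _ _ _ _) => //;
by exists (fun x => match x with inl v => of_void _ v | inr v => v end) => // -[].
Defined.

Lemma class_union0c : left_id class_empty class_union.
Proof.
move=> c; rewrite -(class_of_rep c) class_unionE.
apply/class_of_eq/diagram_iso_sym.
by exists (giso_empty_sum _), (giso_empty_sum _); split;
  apply/setP => -[[[]|x] [[]|y]];
  rewrite mem_rel_image ?mem_rel_sum //; exact: inr_inj.
Qed.

Let giso_sum_empty (G : graph) : giso G (graph_sum G graph_empty).
Proof.
refine (@GIso G (graph_sum G graph_empty) inl inl _ _ _ _) => //;
by exists (fun x => match x with inr v => of_void _ v | inl v => v end) => // -[].
Defined.

Lemma class_unionc0 : right_id class_empty class_union.
Proof.
move=> c; rewrite -(class_of_rep c) class_unionE.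
apply/class_of_eq/diagram_iso_sym.
by exists (giso_sum_empty _), (giso_sum_empty _); split;
  apply/setP => -[[x|[]] [y|[]]];
  rewrite mem_rel_image ?mem_rel_sum //; exact: inl_inj.
Qed.

Let giso_of_empty (G : graph) : is_empty_graph G -> giso graph_empty G.
Proof.
case=> /card0_eq hV /card0_eq hE.
refine (@GIso graph_empty G (of_void _) (of_void _) _ _ _ _); try by case.
- by exists (fun w => False_rect _ (notF (etrans (esym (hV w)) erefl))) => -x;
    [case: x|have := hV x].
- by exists (fun w => False_rect _ (notF (etrans (esym (hE w)) erefl))) => -x;
    [case: x|have := hE x].
Defined.

Lemma class_of_empty (X : rule_diagram) :
  is_empty_rule X -> class_of X = class_empty.
Proof.
case=> eI eO; apply/class_of_eq/diagram_iso_sym.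
have nI : forall x : vtx (lhs X), False by case: eI => /card0_eq h _ x; have := h x.
have nO : forall x : vtx (rhs X), False by case: eO => /card0_eq h _ x; have := h x.
exists (giso_of_empty eI), (giso_of_empty eO).
by split; apply/setP => -[x y]; case: (nI _); (exact: x || exact: y ||
  exact: src x || exact: src y).
Qed.

Lemma class_decomposition (c : diagram_class) :
  exists s : seq primitive_class,
    c = \big[class_union/class_empty]_(q <- s) val q.
Proof.
pose sz (X : prediagram) :=
  (#|vtx (lhs X)| + #|edg (lhs X)| + (#|vtx (rhs X)| + #|edg (rhs X)|))%N.
have sz_iso X Y : diagram_iso X Y -> sz X = sz Y.
  case=> i [o _]; rewrite /sz (bij_eq_card (isoV_bij i)) (bij_eq_card (isoE_bij i)).
  by rewrite (bij_eq_card (isoV_bij o)) (bij_eq_card (isoE_bij o)).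
have sz0 (X : rule_diagram) : sz X = 0%N -> is_empty_rule X.
  by rewrite /sz => /eqP; rewrite !addn_eq0 => /andP[/andP[/eqP ? /eqP ?]
    /andP[/eqP ? /eqP ?]].
have [n] := ubnP (sz (rep c)); elim: n c => // n IHn c; rewrite ltnS => le_n.
have [/class_of_empty|ne] := pselect (is_empty_rule (rep c)).
  by rewrite class_of_rep => ->; exists [::]; rewrite big_nil.
have [pc|] := pselect (primitive (rep c)).
  exists [:: Sub c (asboolT pc) : primitive_class]; rewrite big_cons big_nil.
  by rewrite class_unionc0 SubK.
move=> npc; have [X1 [X2 [iX ne1 ne2]]] : exists X1 X2 : rule_diagram,
    [/\ diagram_iso (rep c) (rd_sum X1 X2), ~ is_empty_rule X1 &
        ~ is_empty_rule X2].
  apply: contrapT => h; apply: npc; split=> // X1 X2 iX.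
  have [e1|n1] := pselect (is_empty_rule X1); first by left.
  have [e2|n2] := pselect (is_empty_rule X2); first by right.
  by case: h; exists X1, X2.
have szs : sz (rep c) = (sz X1 + sz X2)%N.
  rewrite (sz_iso _ _ iX) /sz /= !card_sum [RHS]addnACA.
  by congr (_ + _)%N; exact: addnACA.
have sz1 : (0 < sz X1)%N by rewrite lt0n; apply/eqP => /sz0.
have sz2 : (0 < sz X2)%N by rewrite lt0n; apply/eqP => /sz0.
have szr X : sz (rep (class_of X)) = sz X.
  by apply: sz_iso; apply/class_of_eq; rewrite class_of_rep.
have [|s1 e1] := IHn (class_of X1).
  by rewrite szr; apply: leq_trans le_n; rewrite szs -addn1 leq_add2l.
have [|s2 e2] := IHn (class_of X2).
  by rewrite szr; apply: leq_trans le_n; rewrite szs -add1n leq_add2r.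
exists (s1 ++ s2).
have -> : c = class_union (class_of X1) (class_of X2).
  by rewrite class_unionE -[LHS]class_of_rep; apply/class_of_eq.
rewrite {}e1 {}e2; elim: s1 => [|q s1 IHs]; first by rewrite big_nil class_union0c.
by rewrite /= !big_cons -class_unionA IHs.
Qed.
End UnionLemmas.

Section Algebra.
Variable K : fieldType.

Definition rule_algebra := {malg K[diagram_class]}.
HB.instance Definition _ := GRing.Lmodule.on rule_algebra.

Definition basis (c : diagram_class) : rule_algebra := << c >>.

Definition matching (A B : rule_diagram) : Type :=
  {m : {set vtx (rhs B) * vtx (lhs A)} * {set edg (rhs B) * edg (lhs A)} |
     `[< [/\ one_to_one m.1, one_to_one m.2 &
             is_rule_diagram (diagram_glue (A := A) (B := B) m)] >]}.
HB.instance Definition _ A B := Finite.on (matching A B).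

Definition glue (A B : rule_diagram) (m : matching A B) : rule_diagram :=
  RuleDiagram (let: And3 _ _ h := asboolW (valP m) in h).

Definition class_compose (a b : diagram_class) : rule_algebra :=
  \sum_(m : matching (rep a) (rep b)) basis (class_of (glue m)).

Definition compose (x y : rule_algebra) : rule_algebra :=
  \sum_(a <- msupp x) \sum_(b <- msupp y) (x@_a * y@_b) *: class_compose a b.

End Algebra.

(* Main.v *)
(* View the vertices and edges of a rule diagram as the nodes of an undirected
   graph.  A closed set of nodes splits a rule diagram into a disjoint union of
   rule diagrams, because a connected rule r_i lies entirely inside or outside
   of it; so primitive diagrams are exactly the connected ones, and counting the
   components isomorphic to a given diagram shows that the decomposition into
   primitives is unique.  In the composition of two diagrams the empty matching
   contributes the disjoint union, with coefficient 1, and every other matching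
   joins two components.  Hence the ordered monomial of a sorted word w is the
   disjoint union of w plus diagrams with fewer than |w| components: the
   transition matrix from sorted words to diagrams is unitriangular. *)

Require Import Defs.
From HB Require Import structures.
From mathcomp Require Import all_boot all_order all_algebra.
From mathcomp Require Import generic_quotient boolp finmap.
From mathcomp Require Import monalg.
Set Implicit Arguments.
Unset Strict Implicit.
Unset Printing Implicit Defensive.
Import GRing.Theory.
Local Open Scope ring_scope.

(** * Components *)

Section Components.
Local Open Scope nat_scope.

(* The vertices and edges of both graphs of [X], as the nodes of one undirected
   graph whose components are the primitive summands of [X]. *)
Definition elt (X : prediagram) : finType :=
  ((vtx (lhs X) + edg (lhs X)) + (vtx (rhs X) + edg (rhs X)))%type.

Definition link (X : prediagram) (x y : elt X) : bool :=
  match x, y with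
  | inl (inr e), inl (inl v) => (src e == v) || (tgt e == v)
  | inr (inr e), inr (inl v) => (src e == v) || (tgt e == v)
  | inl (inl v), inr (inl w) => ((v, w) \in relV X) || ((w, v) \in matV X)
  | inl (inr e), inr (inr f) => ((e, f) \in relE X) || ((f, e) \in matE X)
  | _, _ => false
  end.

Definition adj (X : prediagram) : rel (elt X) :=
  fun x y => link x y || link y x.

Lemma adj_sym X : symmetric (@adj X).
Proof. by move=> x y; rewrite /adj orbC. Qed.

Lemma adj_csym X : connect_sym (@adj X).
Proof. exact: sym_connect_sym (@adj_sym X). Qed.

Definition ncomp (X : prediagram) : nat := n_comp (@adj X) predT.

(** * Embeddings of diagrams and their effect on components *)

Record gmorph (G H : graph) := GMorph {
  morV : vtx G -> vtx H;
  morE : edg G -> edg H;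
  mor_src : forall e, src (morE e) = morV (src e);
  mor_tgt : forall e, tgt (morE e) = morV (tgt e) }.

Definition gmorph_of_giso (G H : graph) (i : giso G H) : gmorph G H :=
  GMorph (iso_src i) (iso_tgt i).

Definition gmorph_comp (G H L : graph) (j : gmorph H L) (i : gmorph G H) :
  gmorph G L.
Proof.
refine (@GMorph G L (morV j \o morV i) (morE j \o morE i) _ _).
- by move=> e /=; rewrite !mor_src.
- by move=> e /=; rewrite !mor_tgt.
Defined.

(** All four relations are reflected as well as preserved, so the image carries the induced diagram
    structure of [Y]. *)
Record embedding (X Y : prediagram) := Embedding {
  embI : gmorph (lhs X) (lhs Y);
  embO : gmorph (rhs X) (rhs Y);
  embIV_inj : injective (morV embI);
  embIE_inj : injective (morE embI);
  embOV_inj : injective (morV embO);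
  embOE_inj : injective (morE embO);
  emb_relV : forall v w,
    ((morV embI v, morV embO w) \in relV Y) = ((v, w) \in relV X);
  emb_relE : forall v w,
    ((morE embI v, morE embO w) \in relE Y) = ((v, w) \in relE X);
  emb_matV : forall v w,
    ((morV embO v, morV embI w) \in matV Y) = ((v, w) \in matV X);
  emb_matE : forall v w,
    ((morE embO v, morE embI w) \in matE Y) = ((v, w) \in matE X) }.

Definition emb_elt X Y (f : embedding X Y) (x : elt X) : elt Y :=
  match x with
  | inl (inl v) => inl (inl (morV (embI f) v))
  | inl (inr e) => inl (inr (morE (embI f) e))
  | inr (inl v) => inr (inl (morV (embO f) v))
  | inr (inr e) => inr (inr (morE (embO f) e))
  end.

Lemma emb_elt_inj X Y (f : embedding X Y) : injective (emb_elt f).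
Proof.
by move=> [[v|v]|[v|v]] [[w|w]|[w|w]] //= [];
  [move/embIV_inj->|move/embIE_inj->|move/embOV_inj->|move/embOE_inj->].
Qed.

Lemma link_emb X Y (f : embedding X Y) x y :
  link (emb_elt f x) (emb_elt f y) = link x y.
Proof.
case: x y => [[v|v]|[v|v]] [[w|w]|[w|w]] //=;
rewrite ?emb_relV ?emb_relE ?emb_matV ?emb_matE ?mor_src ?mor_tgt //.
- by rewrite !(inj_eq (@embIV_inj _ _ f)).
- by rewrite !(inj_eq (@embOV_inj _ _ f)).
Qed.

Lemma adj_emb X Y (f : embedding X Y) x y :
  adj (emb_elt f x) (emb_elt f y) = adj x y.
Proof. by rewrite /adj !link_emb. Qed.

(** In other words, the image is a union of components of [Y]. *)
Definition closed_embedding X Y (f : embedding X Y) : Prop :=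
  closed (@adj Y) (codom (emb_elt f)).

(** An embedding is injective and both preserves and reflects adjacency, so [strict_adjunction]
    applies. The adjunction transports connectivity and component counts between [X] and [Y]. *)
Lemma closed_emb_adjunction X Y (f : embedding X Y) (b : {pred elt Y}) :
  closed (@adj Y) b -> b \subset codom (emb_elt f) ->
  rel_adjunction (emb_elt f) (@adj Y) (@adj X) b.
Proof.
move=> clb bf; apply: strict_adjunction clb (@emb_elt_inj _ _ f) bf _.
- exact: adj_csym.
- by move=> x y _; rewrite /= adj_emb.
Qed.

Lemma connect_emb X Y (f : embedding X Y) : closed_embedding f ->
  forall x y, connect (@adj Y) (emb_elt f x) (emb_elt f y)
              = connect (@adj X) x y.
Proof.
move=> clf x y; have [_ h] := closed_emb_adjunction clf (subxx _).
by rewrite h // codom_f.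
Qed.

Lemma n_comp_emb X Y (f : embedding X Y) (a : {pred elt Y}) :
  closed_embedding f -> closed (@adj Y) a ->
  n_comp (@adj Y) [predI codom (emb_elt f) & a]
  = n_comp (@adj X) [preim emb_elt f of a].
Proof.
move=> clf cla; set b := [predI _ & _].
have clb : closed (@adj Y) b.
  by move=> x y xy; rewrite !inE (clf _ _ xy) (cla _ _ xy).
rewrite (adjunction_n_comp (emb_elt f) (@adj_csym Y) (@adj_csym X) clb).
  by apply: eq_n_comp_r => x; rewrite !inE codom_f.
by apply: closed_emb_adjunction clb _; apply/subsetP => x /andP[].
Qed.

Definition emb_comp X Y Z (g : embedding Y Z) (f : embedding X Y) :
  embedding X Z.
Proof.
refine (@Embedding X Z (gmorph_comp (embI g) (embI f))
  (gmorph_comp (embO g) (embO f)) _ _ _ _ _ _ _ _).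
- exact: inj_comp (@embIV_inj _ _ g) (@embIV_inj _ _ f).
- exact: inj_comp (@embIE_inj _ _ g) (@embIE_inj _ _ f).
- exact: inj_comp (@embOV_inj _ _ g) (@embOV_inj _ _ f).
- exact: inj_comp (@embOE_inj _ _ g) (@embOE_inj _ _ f).
- by move=> v w; rewrite /= !emb_relV.
- by move=> v w; rewrite /= !emb_relE.
- by move=> v w; rewrite /= !emb_matV.
- by move=> v w; rewrite /= !emb_matE.
Defined.

Lemma emb_elt_comp X Y Z (g : embedding Y Z) (f : embedding X Y) x :
  emb_elt (emb_comp g f) x = emb_elt g (emb_elt f x).
Proof. by case: x => [[]|[]]. Qed.

(** An embedding keeps the four sorts of nodes apart, so [h] can be chosen sort by sort; its
    morphism laws and its compatibility with the relations then follow by cancelling [f]. *)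
Lemma emb_factor X Y Z (f : embedding Y Z) (g : embedding X Z) :
  {subset codom (emb_elt g) <= codom (emb_elt f)} ->
  exists h : embedding X Y, forall x, emb_elt g x = emb_elt f (emb_elt h x).
Proof.
move=> sgf.
have sub x : exists y, emb_elt g x = emb_elt f y.
  by case/codomP: (sgf _ (codom_f _ x)) => y; exists y.
have /choice[hIV eIV] : forall v, exists w, morV (embI g) v = morV (embI f) w.
  by move=> v; have [[[w|w]|[w|w]] //= [?]] := sub (inl (inl v)); exists w.
have /choice[hIE eIE] : forall v, exists w, morE (embI g) v = morE (embI f) w.
  by move=> v; have [[[w|w]|[w|w]] //= [?]] := sub (inl (inr v)); exists w.
have /choice[hOV eOV] : forall v, exists w, morV (embO g) v = morV (embO f) w.
  by move=> v; have [[[w|w]|[w|w]] //= [?]] := sub (inr (inl v)); exists w.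
have /choice[hOE eOE] : forall v, exists w, morE (embO g) v = morE (embO f) w.
  by move=> v; have [[[w|w]|[w|w]] //= [?]] := sub (inr (inr v)); exists w.
unshelve eexists (@Embedding X Y (@GMorph _ _ hIV hIE _ _)
  (@GMorph _ _ hOV hOE _ _) _ _ _ _ _ _ _ _) => /=.
- by move=> e; apply: (@embIV_inj _ _ f); rewrite -mor_src -eIE -eIV mor_src.
- by move=> e; apply: (@embIV_inj _ _ f); rewrite -mor_tgt -eIE -eIV mor_tgt.
- by move=> e; apply: (@embOV_inj _ _ f); rewrite -mor_src -eOE -eOV mor_src.
- by move=> e; apply: (@embOV_inj _ _ f); rewrite -mor_tgt -eOE -eOV mor_tgt.
- by move=> v w e; apply: (@embIV_inj _ _ g); rewrite !eIV e.
- by move=> v w e; apply: (@embIE_inj _ _ g); rewrite !eIE e.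
- by move=> v w e; apply: (@embOV_inj _ _ g); rewrite !eOV e.
- by move=> v w e; apply: (@embOE_inj _ _ g); rewrite !eOE e.
- by move=> v w; rewrite -(emb_relV f) -(emb_relV g) eIV eOV.
- by move=> v w; rewrite -(emb_relE f) -(emb_relE g) eIE eOE.
- by move=> v w; rewrite -(emb_matV f) -(emb_matV g) eIV eOV.
- by move=> v w; rewrite -(emb_matE f) -(emb_matE g) eIE eOE.
by move=> [[v|v]|[v|v]] /=; rewrite ?eIV ?eIE ?eOV ?eOE.
Qed.

Definition emb_of_iso (X Y : prediagram)
    (i : giso (lhs X) (lhs Y)) (o : giso (rhs X) (rhs Y)) :
  [/\ relV Y = rel_image (isoV i) (isoV o) (relV X),
      relE Y = rel_image (isoE i) (isoE o) (relE X),
      matV Y = rel_image (isoV o) (isoV i) (matV X) &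
      matE Y = rel_image (isoE o) (isoE i) (matE X)] -> embedding X Y.
Proof.
case=> eV eE mV mE.
refine (@Embedding X Y (gmorph_of_giso i) (gmorph_of_giso o) _ _ _ _ _ _ _ _).
- exact: bij_inj (isoV_bij i).
- exact: bij_inj (isoE_bij i).
- exact: bij_inj (isoV_bij o).
- exact: bij_inj (isoE_bij o).
- by move=> v w; rewrite eV mem_rel_image //; apply: bij_inj; apply: isoV_bij.
- by move=> v w; rewrite eE mem_rel_image //; apply: bij_inj; apply: isoE_bij.
- by move=> v w; rewrite mV mem_rel_image //; apply: bij_inj; apply: isoV_bij.
- by move=> v w; rewrite mE mem_rel_image //; apply: bij_inj; apply: isoE_bij.
Defined.

Lemma emb_of_diagram_iso X Y : diagram_iso X Y ->
  exists f : embedding X Y, forall y, y \in codom (emb_elt f).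
Proof.
case=> i [o e]; exists (emb_of_iso e); move: e => [eV eE mV mE].
have [iV _ iVK] := isoV_bij i; have [iE _ iEK] := isoE_bij i.
have [oV _ oVK] := isoV_bij o; have [oE _ oEK] := isoE_bij o.
by move=> [[v|v]|[v|v]]; apply/codomP;
  [exists (inl (inl (iV v)))|exists (inl (inr (iE v)))|
   exists (inr (inl (oV v)))|exists (inr (inr (oE v)))];
  rewrite /= ?iVK ?iEK ?oVK ?oEK.
Qed.

Lemma inj_surj_bij (A B : Type) (f : A -> B) :
  injective f -> (forall y, exists x, y = f x) -> bijective f.
Proof.
by move=> fI /choice[g gK]; exists g => x //; apply: fI; rewrite -gK.
Qed.

Lemma diagram_iso_of_emb X Y (f : embedding X Y) :
  (forall y, y \in codom (emb_elt f)) -> diagram_iso X Y.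
Proof.
move=> fs; have {}fs y : exists x, y = emb_elt f x by apply/codomP.
have bIV : bijective (morV (embI f)).
  apply: inj_surj_bij (@embIV_inj _ _ f) _ => v.
  by have [[[w|w]|[w|w]] //= [?]] := fs (inl (inl v)); exists w.
have bIE : bijective (morE (embI f)).
  apply: inj_surj_bij (@embIE_inj _ _ f) _ => v.
  by have [[[w|w]|[w|w]] //= [?]] := fs (inl (inr v)); exists w.
have bOV : bijective (morV (embO f)).
  apply: inj_surj_bij (@embOV_inj _ _ f) _ => v.
  by have [[[w|w]|[w|w]] //= [?]] := fs (inr (inl v)); exists w.
have bOE : bijective (morE (embO f)).
  apply: inj_surj_bij (@embOE_inj _ _ f) _ => v.
  by have [[[w|w]|[w|w]] //= [?]] := fs (inr (inr v)); exists w.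
exists (GIso bIV bIE (mor_src (embI f)) (mor_tgt (embI f))).
exists (GIso bOV bOE (mor_src (embO f)) (mor_tgt (embO f))).
split; apply/setP => -[v w] /=.
- have [h _ hK] := bIV; have [k _ kK] := bOV; rewrite -[v]hK -[w]kK.
  by rewrite emb_relV mem_rel_image //; exact: bij_inj.
- have [h _ hK] := bIE; have [k _ kK] := bOE; rewrite -[v]hK -[w]kK.
  by rewrite emb_relE mem_rel_image //; exact: bij_inj.
- have [h _ hK] := bOV; have [k _ kK] := bIV; rewrite -[v]hK -[w]kK.
  by rewrite emb_matV mem_rel_image //; exact: bij_inj.
- have [h _ hK] := bOE; have [k _ kK] := bIE; rewrite -[v]hK -[w]kK.
  by rewrite emb_matE mem_rel_image //; exact: bij_inj.
Qed.

(* The component of [x] is isomorphic to [Q].  Phrasing this by embeddings avoids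
   forming the component as a diagram of its own. *)
Definition is_copy (Q X : prediagram) (x : elt X) : bool :=
  `[< exists f : embedding Q X, connect (@adj X) x =i codom (emb_elt f) >].

(** The number of components of [X] isomorphic to [Q]: [n_comp] counts the roots lying in a set, and
    these count components because [is_copy] is closed. *)
Definition mult (Q X : prediagram) : nat := n_comp (@adj X) (@is_copy Q X).

Lemma is_copy_closed Q X : closed (@adj X) (@is_copy Q X).
Proof.
apply: intro_closed => [|x y xy]; first exact: adj_csym.
move=> /asboolP[f fx]; apply/asboolP; exists f => z; rewrite -fx.
by have /(_ _ _ xy) h := same_connect1 (@adj_csym X); rewrite !inE h.
Qed.

(** A closed embedding maps the component of [x] onto the component of its image. Hence a copy
    around [x] composes with [f], and a copy around the image factors through [f]. *)
Lemma is_copy_emb Q X Y (f : embedding X Y) : closed_embedding f ->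
  forall x, is_copy Q (emb_elt f x) = is_copy Q x.
Proof.
move=> clf x; have clc := closed_connect clf.
have cE y : connect (@adj Y) (emb_elt f x) y -> exists z, y = emb_elt f z.
  by move=> xy; apply/codomP; rewrite -(clc _ _ xy) codom_f.
apply/asboolP/asboolP => -[g gx].
  have [h hE] : exists h : embedding Q X,
      forall z, emb_elt g z = emb_elt f (emb_elt h z).
    apply: emb_factor => y; rewrite -gx => xy.
    by rewrite -(clc _ _ xy) codom_f.
  exists h => y; rewrite inE -(connect_emb clf) -[connect _ _ _]/(_ \in connect _ _).
  rewrite gx; apply/codomP/codomP => -[z].
    by rewrite hE => /emb_elt_inj->; exists z.
  by move=> ->; exists z; rewrite hE.
exists (emb_comp f g) => y; apply/idP/codomP.
  move=> xy; have [z yz] := cE _ xy; move: xy; rewrite yz inE (connect_emb clf).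
  by rewrite -[connect _ _ _]/(_ \in connect _ _) gx => /codomP[u ->]; exists u;
    rewrite emb_elt_comp.
case=> z ->; rewrite emb_elt_comp inE (connect_emb clf).
by rewrite -[connect _ _ _]/(_ \in connect _ _) gx codom_f.
Qed.

(** * Components of a disjoint union *)

Definition emb_suml X Y : embedding X (diagram_sum X Y).
Proof.
unshelve refine (@Embedding X (diagram_sum X Y)
  (@GMorph (lhs X) (graph_sum (lhs X) (lhs Y)) inl inl _ _)
  (@GMorph (rhs X) (graph_sum (rhs X) (rhs Y)) inl inl _ _) _ _ _ _ _ _ _ _);
by [| exact: inl_inj | move=> v w; rewrite mem_rel_sum].
Defined.

Definition emb_sumr X Y : embedding Y (diagram_sum X Y).
Proof.
unshelve refine (@Embedding Y (diagram_sum X Y)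
  (@GMorph (lhs Y) (graph_sum (lhs X) (lhs Y)) inr inr _ _)
  (@GMorph (rhs Y) (graph_sum (rhs X) (rhs Y)) inr inr _ _) _ _ _ _ _ _ _ _);
by [| exact: inr_inj | move=> v w; rewrite mem_rel_sum].
Defined.

Lemma emb_suml_codom X Y (z : elt (diagram_sum X Y)) :
  (z \in codom (emb_elt (emb_suml X Y))) =
  match z with
  | inl (inl (inl _)) | inl (inr (inl _)) | inr (inl (inl _))
  | inr (inr (inl _)) => true
  | _ => false
  end.
Proof.
apply/codomP; case: z => [[[v|v]|[v|v]]|[[v|v]|[v|v]]];
  try by case=> -[[w|w]|[w|w]].
- by exists (inl (inl v)).
- by exists (inl (inr v)).
- by exists (inr (inl v)).
- by exists (inr (inr v)).
Qed.

Lemma emb_sumr_codom X Y (z : elt (diagram_sum X Y)) :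
  (z \in codom (emb_elt (emb_sumr X Y))) =
  (z \notin codom (emb_elt (emb_suml X Y))).
Proof.
rewrite emb_suml_codom.
apply/codomP; case: z => [[[v|v]|[v|v]]|[[v|v]|[v|v]]];
  try by case=> -[[w|w]|[w|w]].
- by exists (inl (inl v)).
- by exists (inl (inr v)).
- by exists (inr (inl v)).
- by exists (inr (inr v)).
Qed.

Lemma emb_suml_closed X Y : closed_embedding (emb_suml X Y).
Proof.
move=> x y; rewrite !emb_suml_codom.
by case: x => [[[v|v]|[v|v]]|[[v|v]|[v|v]]];
  case: y => [[[w|w]|[w|w]]|[[w|w]|[w|w]]];
  rewrite /adj /= ?mem_rel_sum ?orbF.
Qed.

Lemma emb_sumr_closed X Y : closed_embedding (emb_sumr X Y).
Proof. by move=> x y /emb_suml_closed h; rewrite !emb_sumr_codom h. Qed.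

(** The images of the two summands are closed and complementary, so every component root lies in
    exactly one of them. *)
Lemma n_comp_sum X Y (a : {pred elt (diagram_sum X Y)}) :
  closed (@adj (diagram_sum X Y)) a ->
  n_comp (@adj (diagram_sum X Y)) a =
  n_comp (@adj X) [preim emb_elt (emb_suml X Y) of a]
  + n_comp (@adj Y) [preim emb_elt (emb_sumr X Y) of a].
Proof.
move=> cla; rewrite -(n_comp_emb (@emb_suml_closed X Y) cla).
rewrite -(n_comp_emb (@emb_sumr_closed X Y) cla) /n_comp_mem.
rewrite -(cardID [in codom (emb_elt (emb_suml X Y))]).
congr (_ + _); apply: eq_card => z; rewrite !inE ?emb_sumr_codom /=.
  by rewrite [RHS]andbCA andbC.
by rewrite [RHS]andbCA.
Qed.

Lemma n_comp_iso X Y (f : embedding X Y) (a : {pred elt Y}) :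
  (forall y, y \in codom (emb_elt f)) -> closed (@adj Y) a ->
  n_comp (@adj Y) a = n_comp (@adj X) [preim emb_elt f of a].
Proof.
move=> fs cla; rewrite -n_comp_emb //; last by move=> x y _; rewrite !fs.
by apply: eq_n_comp_r => y; rewrite !inE fs.
Qed.

Lemma mult_sum Q X Y : mult Q (diagram_sum X Y) = mult Q X + mult Q Y.
Proof.
rewrite /mult n_comp_sum; last exact: is_copy_closed.
congr (_ + _); apply: eq_n_comp_r => x; rewrite !inE; apply: is_copy_emb.
  exact: emb_suml_closed.
exact: emb_sumr_closed.
Qed.

Lemma mult_iso Q X Y : diagram_iso X Y -> mult Q X = mult Q Y.
Proof.
case/emb_of_diagram_iso=> f fs; rewrite /mult (n_comp_iso fs).
  by apply: eq_n_comp_r => x; apply: esym; apply: is_copy_emb => y z _; rewrite !fs.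
exact: is_copy_closed.
Qed.

Lemma ncomp_sum X Y : ncomp (diagram_sum X Y) = ncomp X + ncomp Y.
Proof. exact: n_comp_sum. Qed.

Lemma ncomp_iso X Y : diagram_iso X Y -> ncomp X = ncomp Y.
Proof. by case/emb_of_diagram_iso=> f fs; rewrite /ncomp (n_comp_iso fs). Qed.

(** The empty diagram satisfies this as well, with zero components; hence the witness node [x] in
    the next two lemmas. *)
Definition connected (X : prediagram) : Prop :=
  forall x y : elt X, connect (@adj X) x y.

Lemma ncomp_connected X (x : elt X) : connected X -> ncomp X = 1.
Proof.
move=> cX; rewrite -(n_comp_connect (@adj_csym X) x).
by apply: eq_n_comp_r => y; apply: esym; apply: cX.
Qed.

Lemma mult_connected Q X (x : elt X) : connected X ->
  mult Q X = `[< diagram_iso Q X >].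
Proof.
move=> cX; have copyE (y : elt X) : is_copy Q y = `[< diagram_iso Q X >].
  apply: asbool_equiv_eq; split=> [[f fx]|].
    by apply: (@diagram_iso_of_emb _ _ f) => z; rewrite -fx; apply: cX.
  by case/emb_of_diagram_iso=> f fs; exists f => z; rewrite fs; apply: cX.
case: asboolP copyE => h copyE.
  rewrite -[RHS](n_comp_connect (@adj_csym X) x).
  apply: eq_n_comp_r => y; rewrite [LHS]copyE; apply: esym; exact: cX.
by apply: eq_card0 => y; apply/andP => -[_]; rewrite /= [X in is_true X]copyE.
Qed.

End Components.

(** * Splitting off components *)

Section Splitting.
Local Open Scope nat_scope.

(** The increasing enumeration of [S]; its monotonicity preserves the condition that matchings lower
    the constituent number. *)
Lemma ord_subset_enum (n : nat) (S : {set 'I_n}) :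
  exists (k : nat) (h : 'I_k -> 'I_n),
    [/\ {mono h : a b / a < b}, forall b, h b \in S &
        forall i, i \in S -> exists b, i = h b].
Proof.
exists #|S|, (Order.enum_val (A := mem S)); split=> [a b|b|i iS].
- have := Order.POrderTheory.leW_mono
    (Order.EnumVal.le_enum_val (A := mem S) (@Order.TotalTheory.le_total _ 'I_n)).
  by move/(_ a b); rewrite !ltEord.
- exact: Order.EnumVal.enum_valP.
- exists (Order.enum_rank_in iS i).
  by rewrite Order.EnumVal.enum_rankK_in.
Qed.

(* [has_constituents] requires every number to be used, so the constituents that
   became empty are removed by renumbering the others monotonically. *)
Lemma has_constituents_nonempty (X : prediagram) (n : nat)
    (cI : decomposition (lhs X) n) (cO : decomposition (rhs X) n) :
  (forall x y, (x, y) \in relV X -> numV cI x = numV cO y) ->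
  (forall x y, (x, y) \in relE X -> numE cI x = numE cO y) ->
  (forall i, ~ is_empty_rule (constituent cI cO i) ->
     connected_rule (constituent cI cO i)) ->
  (forall y x, (y, x) \in matV X -> numV cI x < numV cO y) ->
  (forall y x, (y, x) \in matE X -> numE cI x < numE cO y) ->
  has_constituents X.
Proof.
move=> hV hE hc hmV hmE.
have [k [h [hlt hS Sh]]] :=
  ord_subset_enum [set i | ~~ `[< is_empty_rule (constituent cI cO i) >]].
have hI : injective h.
  move=> a b eab; have [||] := ltngtP a b; last by move/val_inj.
    by rewrite -hlt eab ltnn.
  by rewrite -hlt eab ltnn.
have inS i : ~ is_empty_rule (constituent cI cO i) -> exists b, i = h b.
  by move=> ne; apply: Sh; rewrite inE; apply/asboolP.
(* The constituent numbered by a node contains that node, so it is nonempty and its number is a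
   value of [h]. *)
have /choice[nIV nIVE] : forall v, exists b, numV cI v = h b.
  move=> v; apply: inS => -[[/card0_eq h0 _] _].
  by have := h0 (exist _ v (eqxx _)); rewrite inE.
have /choice[nIE nIEE] : forall v, exists b, numE cI v = h b.
  move=> v; apply: inS => -[[_ /card0_eq h0] _].
  by have := h0 (exist _ v (eqxx _)); rewrite inE.
have /choice[nOV nOVE] : forall v, exists b, numV cO v = h b.
  move=> v; apply: inS => -[_ [/card0_eq h0 _]].
  by have := h0 (exist _ v (eqxx _)); rewrite inE.
have /choice[nOE nOEE] : forall v, exists b, numE cO v = h b.
  move=> v; apply: inS => -[_ [_ /card0_eq h0]].
  by have := h0 (exist _ v (eqxx _)); rewrite inE.
unshelve eexists k, (@Decomposition (lhs X) k nIV nIE _ _),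
  (@Decomposition (rhs X) k nOV nOE _ _);
  try by move=> e; apply: hI; rewrite -?nIVE -?nIEE -?nOVE -?nOEE ?num_src ?num_tgt.
split=> /=.
- split=> x y xy; apply: hI.
    by rewrite -nIVE -nOVE; apply: hV.
  by rewrite -nIEE -nOEE; apply: hE.
- move=> b; have := hS b; rewrite inE => /asboolPn/hc.
  apply: connected_rule_iso.
  apply: (@constituent_iso X X n k cI cO _ _ (h b) b id id id id) => //=;
    try by [move=> w _; exists w];
    by move=> v; rewrite ?nIVE ?nIEE ?nOVE ?nOEE inj_eq.
- by move=> y x yx; rewrite -hlt -nIVE -nOVE; apply: hmV.
- by move=> y x yx; rewrite -hlt -nIEE -nOEE; apply: hmE.
Qed.

Lemma one_to_one_suml (A B C D : finType) (R : {set A * C}) (S : {set B * D}) :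
  one_to_one (rel_sum R S) -> one_to_one R.
Proof.
move=> o [a b] [a' b'] h h' ne.
have /= := o (inl a, inl b) (inl a', inl b'); rewrite !mem_rel_sum.
move=> /(_ h h')[|n1 n2]; first by case=> ea eb; apply: ne; rewrite ea eb.
by split=> e; [apply: n1|apply: n2]; rewrite e.
Qed.

Lemma linear_rule_suml R S : linear_rule (rule_sum R S) -> linear_rule R.
Proof.
case=> oV oE hst; split.
- exact: one_to_one_suml oV.
- exact: one_to_one_suml oE.
- by move=> e e' h; have := hst (inl e) (inl e'); rewrite !mem_rel_sum; apply.
Qed.

Definition sum_swap (A B : Type) (x : A + B) : B + A :=
  match x with inl a => inr a | inr b => inl b end.

Lemma sum_swapK A B : cancel (@sum_swap A B) (@sum_swap B A).
Proof. by case. Qed.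

Definition giso_swap (G H : graph) : giso (graph_sum G H) (graph_sum H G).
Proof.
refine (@GIso (graph_sum G H) (graph_sum H G) (@sum_swap _ _) (@sum_swap _ _)
  (Bijective (@sum_swapK _ _) (@sum_swapK _ _))
  (Bijective (@sum_swapK _ _) (@sum_swapK _ _)) _ _); by case.
Defined.

Lemma rel_sum_swap (A B C D : finType) (R : {set A * C}) (S : {set B * D}) :
  rel_sum S R = rel_image (@sum_swap _ _) (@sum_swap _ _) (rel_sum R S).
Proof.
apply/setP => -[x y]; rewrite -[x]sum_swapK -[y]sum_swapK.
rewrite mem_rel_image; try exact: can_inj (@sum_swapK _ _).
by case: x y => x [] y; rewrite !mem_rel_sum.
Qed.

Lemma rule_sumC R S : rule_iso (rule_sum R S) (rule_sum S R).
Proof.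
by exists (giso_swap _ _), (giso_swap _ _); split; apply: rel_sum_swap.
Qed.

Lemma diagram_sumC X Y : diagram_iso (diagram_sum X Y) (diagram_sum Y X).
Proof.
by exists (giso_swap _ _), (giso_swap _ _); split; apply: rel_sum_swap.
Qed.

Lemma linear_rule_sumr R S : linear_rule (rule_sum R S) -> linear_rule S.
Proof. by move/(linear_rule_iso (rule_sumC R S))/linear_rule_suml. Qed.


(** * Constituents of a disjoint union *)

Definition decomposition_pull (G H : graph) n (f : gmorph G H)
    (c : decomposition H n) : decomposition G n.
Proof.
refine (@Decomposition G n (numV c \o morV f) (numE c \o morE f) _ _).
- by move=> e /=; rewrite -mor_src num_src.
- by move=> e /=; rewrite -mor_tgt num_tgt.
Defined.

(** With [inl] and [inr] this identifies a sum of two subtypes with a subtype of the sum, as needed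
    to compare constituents. *)
Definition sub_copair (A B C : Type) (P : pred C) (f : A -> C) (g : B -> C)
    (x : {a | P (f a)} + {b | P (g b)}) : {c | P c} :=
  match x with
  | inl a => exist _ (f (val a)) (valP a)
  | inr b => exist _ (g (val b)) (valP b)
  end.

Lemma sub_copair_bij (A B : Type) (P : pred (A + B)) :
  bijective (@sub_copair A B (A + B) P inl inr).
Proof.
apply: inj_surj_bij.
  by move=> [[a ha]|[b hb]] [[a' ha']|[b' hb']] //= [] e; congr (_ _);
    apply: val_inj.
move=> [[a|b] h]; [exists (inl (exist _ a h))|exists (inr (exist _ b h))];
  exact: val_inj.
Qed.

Section SumConstituents.
Variables (X Y : prediagram) (n : nat).
Variables (cI : decomposition (lhs (diagram_sum X Y)) n).
Variables (cO : decomposition (rhs (diagram_sum X Y)) n).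
Let lI := decomposition_pull (embI (emb_suml X Y)) cI.
Let lO := decomposition_pull (embO (emb_suml X Y)) cO.
Let rI := decomposition_pull (embI (emb_sumr X Y)) cI.
Let rO := decomposition_pull (embO (emb_sumr X Y)) cO.

Lemma constituent_sum_iso i :
  rule_iso (constituent cI cO i)
    (rule_sum (constituent lI lO i) (constituent rI rO i)).
Proof.
apply: rule_iso_sym.
unshelve eexists (@GIso (graph_sum (part lI i) (part rI i)) (part cI i)
  _ _ (sub_copair_bij _) (sub_copair_bij _) _ _);
  try by case=> e; apply: val_inj.
unshelve eexists (@GIso (graph_sum (part lO i) (part rO i)) (part cO i)
  _ _ (sub_copair_bij _) (sub_copair_bij _) _ _);
  try by case=> e; apply: val_inj.
split; apply/setP => -[x y].
  have [f _ fK] := sub_copair_bij (fun v => numV cI v == i).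
  have [g _ gK] := sub_copair_bij (fun v => numV cO v == i).
  rewrite -[x]fK -[y]gK mem_rel_image; try exact/bij_inj/sub_copair_bij.
  by rewrite inE mem_rel_sum; case: (f x) (g y) => u [] w /=;
    rewrite ?inE ?mem_rel_sum.
have [f _ fK] := sub_copair_bij (fun v => numE cI v == i).
have [g _ gK] := sub_copair_bij (fun v => numE cO v == i).
rewrite -[x]fK -[y]gK mem_rel_image; try exact/bij_inj/sub_copair_bij.
by rewrite inE mem_rel_sum; case: (f x) (g y) => u [] w /=;
  rewrite ?inE ?mem_rel_sum.
Qed.

Lemma constituent_suml_iso i : is_empty_rule (constituent rI rO i) ->
  rule_iso (constituent lI lO i) (constituent cI cO i).
Proof.
case=> -[/card0_eq hIV /card0_eq hIE] [/card0_eq hOV /card0_eq hOE].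
apply: (@constituent_iso X (rule_sum X Y) n n lI lO cI cO i i inl inl inl inl);
  try by [ | exact: inl_inj | move=> x y; rewrite mem_rel_sum].
- move=> [v|v] h; first by exists v.
  by have := hIV (exist _ v h); rewrite inE.
- move=> [v|v] h; first by exists v.
  by have := hIE (exist _ v h); rewrite inE.
- move=> [v|v] h; first by exists v.
  by have := hOV (exist _ v h); rewrite inE.
- move=> [v|v] h; first by exists v.
  by have := hOE (exist _ v h); rewrite inE.
Qed.
End SumConstituents.

(** Every constituent of the sum is a disjoint union of a left and a right half. Connectedness makes
    one half empty, so a nonempty left half is the full constituent up to isomorphism; numbers with
    an empty left half are discarded. *)
Lemma is_rule_diagram_suml X Y :
  is_rule_diagram (diagram_sum X Y) -> is_rule_diagram X.
Proof.
case=> -[n [cI [cO [[hV hE] hc hmV hmE]]]] oV oE hom; split; first last.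
- move=> e e' h; have := hom (inl e) (inl e').
  by rewrite !omega_sum !mem_rel_sum; apply.
- exact: one_to_one_suml oE.
- exact: one_to_one_suml oV.
apply: (has_constituents_nonempty (n := n)
  (cI := decomposition_pull (embI (emb_suml X Y)) cI)
  (cO := decomposition_pull (embO (emb_suml X Y)) cO)) => /=.
- by move=> x y xy; apply: hV; rewrite mem_rel_sum.
- by move=> x y xy; apply: hE; rewrite mem_rel_sum.
- move=> i ne; have [li _ ci] := hc i; have isoi := constituent_sum_iso cI cO i.
  have ls := linear_rule_iso isoi li.
  (* The left half is nonempty by [ne], so the right half is the empty one. *)
  have [//|e] := ci _ _ (linear_rule_suml ls) (linear_rule_sumr ls) isoi.
  by apply: connected_rule_iso (hc i); apply/rule_iso_sym/constituent_suml_iso.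
- by move=> y x yx; apply: hmV; rewrite mem_rel_sum.
- by move=> y x yx; apply: hmE; rewrite mem_rel_sum.
Qed.

(** * Restriction to a closed set of nodes *)

Section Restriction.
Variables (X : prediagram) (a : {pred elt X}).
Hypothesis cla : closed (@adj X) a.

(** An edge is adjacent to its source and target, so closedness retains the endpoints of every
    retained edge. *)
Definition restrict_lhs : graph.
Proof.
unshelve refine (@Graph {v : vtx (lhs X) | inl (inl v) \in a}
  {e : edg (lhs X) | inl (inr e) \in a}
  (fun e => exist _ (src (val e)) _) (fun e => exist _ (tgt (val e)) _)).
- by rewrite /= -(@cla (inl (inr (val e)))) ?(valP e) // /adj /= eqxx.
- by rewrite /= -(@cla (inl (inr (val e)))) ?(valP e) // /adj /= eqxx orbT.
Defined.

Definition restrict_rhs : graph.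
Proof.
unshelve refine (@Graph {v : vtx (rhs X) | inr (inl v) \in a}
  {e : edg (rhs X) | inr (inr e) \in a}
  (fun e => exist _ (src (val e)) _) (fun e => exist _ (tgt (val e)) _)).
- by rewrite /= -(@cla (inr (inr (val e)))) ?(valP e) // /adj /= eqxx.
- by rewrite /= -(@cla (inr (inr (val e)))) ?(valP e) // /adj /= eqxx orbT.
Defined.

Definition restrict : prediagram :=
  @Prediagram (@Prerule restrict_lhs restrict_rhs
    [set p | (val p.1, val p.2) \in relV X]
    [set p | (val p.1, val p.2) \in relE X])
    [set p | (val p.1, val p.2) \in matV X]
    [set p | (val p.1, val p.2) \in matE X].
End Restriction.

Definition copair (A B C : Type) (f : A -> C) (g : B -> C) (x : A + B) : C :=
  match x with inl a => f a | inr b => g b end.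

Lemma copair_val_bij (T : Type) (P : pred T) :
  bijective (copair val val : {x | P x} + {x | ~~ P x} -> T).
Proof.
apply: inj_surj_bij.
  move=> [[x h]|[x h]] [[y k]|[y k]] /= e; try by congr (_ _); apply: val_inj.
    by case/negP: k; rewrite -e.
  by case/negP: h; rewrite e.
move=> x; have [h|h] := boolP (P x).
  by exists (inl (exist _ x h)).
by exists (inr (exist _ x h)).
Qed.

(** Pairs never cross from a predicate to its complement, so the two restrictions lose nothing of
    [R]. *)
Lemma rel_sum_restrict (A B : finType) (P : pred A) (Q : pred B)
    (R : {set A * B}) : (forall x y, (x, y) \in R -> P x = Q y) ->
  R = rel_image (copair val val : {x | P x} + {x | ~~ P x} -> A)
                (copair val val : {x | Q x} + {x | ~~ Q x} -> B)
        (rel_sum [set p | (val p.1, val p.2) \in R]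
                 [set p | (val p.1, val p.2) \in R]).
Proof.
move=> PQ; apply/setP => -[x y].
have [f _ fK] := copair_val_bij P; have [g _ gK] := copair_val_bij Q.
rewrite -[x]fK -[y]gK mem_rel_image; try exact/bij_inj/copair_val_bij.
rewrite mem_rel_sum; case: (f x) (g y) => -[u hu] [] [w hw] /=; rewrite ?inE //=.
  by apply/negP => /PQ e; rewrite -e hu in hw.
by apply/negP => /PQ e; rewrite e hw in hu.
Qed.

Lemma restrict_iso (X : prediagram) (a : {pred elt X})
    (cla : closed (@adj X) a) (clc : closed (@adj X) [predC a]) :
  diagram_iso (diagram_sum (restrict cla) (restrict clc)) X.
Proof.
unshelve eexists (@GIso (graph_sum (restrict_lhs cla) (restrict_lhs clc)) (lhs X)
  _ _ (copair_val_bij _) (copair_val_bij _) _ _); try by case.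
unshelve eexists (@GIso (graph_sum (restrict_rhs cla) (restrict_rhs clc)) (rhs X)
  _ _ (copair_val_bij _) (copair_val_bij _) _ _); try by case.
split; apply: rel_sum_restrict => x y xy; apply: cla; rewrite /adj /= xy ?orbT //.
Qed.

(** Splitting [X] into the component of [x] and its complement gives two rule diagrams. Primitivity
    makes one of them empty, and it is not the component, which contains [x]. *)
Lemma primitive_connected (X : rule_diagram) : primitive X -> connected X.
Proof.
case=> ne pX x; pose a := [in connect (@adj X) x].
have cla : closed (@adj X) a by exact: connect_closed (@adj_csym X) x.
have clc : closed (@adj X) [predC a] by exact: predC_closed.
have iX := diagram_iso_sym (restrict_iso cla clc).
have rS := is_rule_diagram_iso iX (rd_axioms X).
have r1 := is_rule_diagram_suml rS.
have r2 := is_rule_diagram_suml (is_rule_diagram_iso (diagram_sumC _ _) rS).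
have [] := pX (RuleDiagram r1) (RuleDiagram r2) iX.
  have xa : x \in a by rewrite inE; apply: connect0.
  case=> -[/card0_eq hIV /card0_eq hIE] [/card0_eq hOV /card0_eq hOE].
  case: {+}x xa => -[v|v] h.
  - by have := hIV (exist _ v h); rewrite inE.
  - by have := hIE (exist _ v h); rewrite inE.
  - by have := hOV (exist _ v h); rewrite inE.
  - by have := hOE (exist _ v h); rewrite inE.
case=> -[/card0_eq hIV /card0_eq hIE] [/card0_eq hOV /card0_eq hOE] y.
apply/negPn/negP => h; have {h} : y \in [predC a] by rewrite inE.
case: y => -[v|v] h.
- by have := hIV (exist _ v h); rewrite inE.
- by have := hIE (exist _ v h); rewrite inE.
- by have := hOV (exist _ v h); rewrite inE.
- by have := hOE (exist _ v h); rewrite inE.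
Qed.

Lemma not_empty_elt (X : prediagram) : ~ is_empty_rule X -> inhabited (elt X).
Proof.
move=> ne; case: (pickP (predT : pred (elt X))) => [x _|h0]; first exact: inhabits x.
by case: ne; split; split; apply: eq_card0 => v;
  [have := h0 (inl (inl v)) | have := h0 (inl (inr v)) |
   have := h0 (inr (inl v)) | have := h0 (inr (inr v))].
Qed.

End Splitting.

(** * Gluing *)

Section Gluing.
Local Open Scope nat_scope.

(** Sending a root of [e'] to its root for [e] is injective, as [e] is contained in [e']. The image
    misses a root of [e], that of [x] or that of [y]: preimages of both would be roots of [e']
    connected in [e'], hence equal, and [x] and [y] would share a root for [e]. *)
Lemma n_comp_lt (T : finType) (e e' : rel T) (x y : T) :
  connect_sym e -> connect_sym e' -> subrel e e' ->
  connect e' x y -> ~~ connect e x y -> n_comp e' predT < n_comp e predT.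
Proof.
move=> se se' sub xy nxy.
have csub u v : connect e u v -> connect e' u v.
  by apply: connect_sub u v => u v /sub; apply: connect1.
have cr (u v : T) : fingraph.root e u = fingraph.root e v -> connect e' u v.
  by move/(fingraph.rootP se); apply: csub.
have inj : {in [predI roots e' & predT] &, injective (fingraph.root e)}.
  move=> u v /andP[/eqP ru _] /andP[/eqP rv _] /cr/(fingraph.rootP se').
  by rewrite ru rv.
rewrite /n_comp_mem -(card_in_image inj); apply: proper_card.
apply/properP; split.
  by apply/subsetP => _ /imageP[u _ ->]; rewrite inE /= roots_root.
have [] := boolP (fingraph.root e x \in [seq fingraph.root e u | u in [predI roots e' & predT]]);
  last by exists (fingraph.root e x) => //; rewrite inE /= roots_root.
case/imageP=> u /andP[/eqP ru _] xu; exists (fingraph.root e y).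
  by rewrite inE /= roots_root.
apply/negP => /imageP[v /andP[/eqP rv _] yv].
have uv : u = v.
  rewrite -ru -rv; apply/(fingraph.rootP se').
  apply: connect_trans (connect_trans _ xy) (cr _ _ yv).
  by rewrite se'; apply: cr.
by case/negP: nxy; apply/(fingraph.rootP se); rewrite xu yv uv.
Qed.

Lemma rel_glue0 (A B C D : finType) (R : {set A * C}) (S : {set B * D}) :
  rel_glue R set0 S = rel_sum R S.
Proof. by apply/setP => -[[a|b] [c|d]]; rewrite !inE. Qed.

Lemma diagram_glue0 (A B : prediagram) :
  diagram_glue (A := A) (B := B) (set0, set0) = diagram_sum A B.
Proof. by rewrite /diagram_glue !rel_glue0. Qed.

(** Gluing and disjoint union have the same nodes and differ only in adjacency. A matched pair joins
    a node of [A] to a node of [B], which lie in different components of the union because the image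
    of [A] is closed. *)
Lemma ncomp_glue (A B : prediagram)
    (m : {set vtx (rhs B) * vtx (lhs A)} * {set edg (rhs B) * edg (lhs A)}) :
  m != (set0, set0) -> ncomp (diagram_glue m) < ncomp A + ncomp B.
Proof.
move=> m0; rewrite -ncomp_sum.
have sub : subrel (@adj (diagram_sum A B)) (@adj (diagram_glue m)).
  by move=> [[[v|v]|[v|v]]|[[v|v]|[v|v]]] [[[w|w]|[w|w]]|[[w|w]|[w|w]]];
    rewrite /adj /= ?mem_rel_sum ?inE ?orbF //= => ->.
have [x [y [xy xA yB]]] : exists x y : elt (diagram_sum A B),
    [/\ @adj (diagram_glue m) x y, x \in codom (emb_elt (emb_suml A B)) &
        y \notin codom (emb_elt (emb_suml A B))].
  case: m {sub} m0 => mV mE; rewrite xpair_eqE negb_and.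
  case/orP=> /set0Pn[[w v] wv].
    exists (inl (inl (inl v))), (inr (inl (inr w))).
    by rewrite !emb_suml_codom; split => //; rewrite /adj /= !inE /= wv ?orbT.
  exists (inl (inr (inl v))), (inr (inr (inr w))).
  by rewrite !emb_suml_codom; split => //; rewrite /adj /= !inE /= wv ?orbT.
apply: (n_comp_lt (@adj_csym (diagram_sum A B)) (@adj_csym (diagram_glue m)) sub
  (connect1 xy)).
apply/negP => c; case/negP: yB.
by rewrite -(closed_connect (@emb_suml_closed A B) c).
Qed.
End Gluing.

(** * Unique decomposition of classes into primitives *)

Section Classes.
Local Open Scope nat_scope.

Lemma class_unionC : commutative class_union.
Proof.
by move=> a b; apply/class_of_eq; exact: diagram_sumC.
Qed.

(** Commutativity lets [perm_big] reorder iterated disjoint unions. *)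
HB.instance Definition _ := Monoid.isComLaw.Build diagram_class class_empty
  class_union class_unionA class_unionC class_union0c.

Definition class_ncomp (c : diagram_class) : nat := ncomp (rep c).

Definition class_mult (q c : diagram_class) : nat := mult (rep q) (rep c).

Lemma rep_class_of (X : rule_diagram) : diagram_iso (rep (class_of X)) X.
Proof. by apply/class_of_eq; rewrite class_of_rep. Qed.

Lemma class_ncomp_of (X : rule_diagram) : class_ncomp (class_of X) = ncomp X.
Proof. exact: ncomp_iso (rep_class_of X). Qed.

Lemma class_ncomp_union a b :
  class_ncomp (class_union a b) = class_ncomp a + class_ncomp b.
Proof. by rewrite class_ncomp_of ncomp_sum. Qed.

Lemma class_mult_union q a b :
  class_mult q (class_union a b) = class_mult q a + class_mult q b.
Proof. by rewrite /class_mult (mult_iso _ (rep_class_of _)) mult_sum. Qed.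

Lemma elt_empty (x : elt diagram_empty) : False.
Proof. by case: x => -[] []. Qed.

Lemma class_ncomp_empty : class_ncomp class_empty = 0.
Proof.
by rewrite class_ncomp_of; apply: eq_card0 => x; case: (elt_empty x).
Qed.

Lemma class_mult_empty q : class_mult q class_empty = 0.
Proof.
rewrite /class_mult (mult_iso _ (rep_class_of _)).
by apply: eq_card0 => x; case: (elt_empty x).
Qed.

Lemma class_ncomp_primitive (p : primitive_class) : class_ncomp (val p) = 1.
Proof.
have pp : primitive (rep (val p)) := asboolW (valP p).
have [x] := not_empty_elt pp.1.
exact: ncomp_connected x (primitive_connected pp).
Qed.

(** A primitive diagram is connected, so its single component is the diagram itself. *)
Lemma class_mult_primitive (q p : primitive_class) :
  class_mult (val q) (val p) = (p == q).
Proof.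
have pp : primitive (rep (val p)) := asboolW (valP p).
have [x] := not_empty_elt pp.1.
rewrite /class_mult (mult_connected _ x (primitive_connected pp)).
congr nat_of_bool; apply/asboolP/eqP => [/class_of_eq|->]; last first.
  exact: diagram_iso_refl.
by rewrite !class_of_rep => /val_inj.
Qed.

Definition class_word (s : seq primitive_class) : diagram_class :=
  \big[class_union/class_empty]_(q <- s) val q.

Lemma class_ncomp_word s : class_ncomp (class_word s) = size s.
Proof.
elim: s => [|q s IHs]; first by rewrite /class_word big_nil class_ncomp_empty.
by rewrite /class_word big_cons class_ncomp_union class_ncomp_primitive IHs.
Qed.

Lemma class_mult_word (q : primitive_class) s :
  class_mult (val q) (class_word s) = count_mem q s.
Proof.
elim: s => [|p s IHs]; first by rewrite /class_word big_nil class_mult_empty.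
by rewrite /class_word big_cons class_mult_union class_mult_primitive IHs.
Qed.

(** Uniqueness of the decomposition into primitives: [class_mult] recovers from the class how often
    each primitive occurs in the word. *)
Lemma class_word_perm s t : class_word s = class_word t <-> perm_eq s t.
Proof.
split=> [e|st]; last exact: perm_big.
by apply/allP => q _; apply/eqP; rewrite -!class_mult_word e.
Qed.
End Classes.

(** * Linear extension from a basis *)

Section LinearExtension.
Variables (K : fieldType) (I : choiceType) (V : lmodType K) (f : I -> V).

Definition lext (x : {malg K[I]}) : V := \sum_(i <- msupp x) x@_i *: f i.

(** Summing over one finite set that contains several supports makes additivity a termwise
    statement. *)
Lemma lextEw (x : {malg K[I]}) (D : {fset I}) : (msupp x `<=` D)%fset ->
  lext x = \sum_(i <- D) x@_i *: f i.
Proof.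
move=> sD; apply: big_fset_incl => // i _ ni.
by rewrite mcoeff_outdom ?scale0r.
Qed.

Lemma lextD : {morph lext : x y / x + y}.
Proof.
move=> x y; pose D := (msupp x `|` msupp y)%fset.
rewrite (@lextEw (x + y) D) ?msuppD_le // (@lextEw x D) ?fsubsetUl //.
rewrite (@lextEw y D) ?fsubsetUr // -big_split; apply: eq_bigr => i _.
by rewrite mcoeffD scalerDl.
Qed.

Lemma lextU (c : K) (i : I) : lext << c *g i >> = c *: f i.
Proof.
by rewrite (lextEw msuppU_le) big_seq_fset1 mcoeffUU.
Qed.

Lemma lext0 : lext 0 = 0.
Proof. by apply: (addrI (lext 0)); rewrite -lextD !addr0. Qed.

Lemma lextN : {morph lext : x / - x}.
Proof. by move=> x; apply: (addrI (lext x)); rewrite -lextD !subrr lext0. Qed.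

Lemma lext_sum (J : Type) (r : seq J) (P : pred J) (F : J -> {malg K[I]}) :
  lext (\sum_(j <- r | P j) F j) = \sum_(j <- r | P j) lext (F j).
Proof. exact: (big_morph lext lextD lext0). Qed.
End LinearExtension.

(** * Leading terms of compositions *)

Section Composition.
Variable K : fieldType.
Local Notation alg := (rule_algebra K).

(** The span of the diagrams with fewer than [n] components; these spans filter the algebra, and
    leading terms are taken with respect to them. *)
Definition lower (n : nat) (x : alg) : Prop :=
  forall c, (n <= class_ncomp c)%N -> x@_c = 0.

Lemma lowerD n x y : lower n x -> lower n y -> lower n (x + y).
Proof. by move=> hx hy c hc; rewrite mcoeffD hx ?hy ?addr0. Qed.

Lemma lowerZ n a x : lower n x -> lower n (a *: x).
Proof. by move=> hx c hc; rewrite mcoeffZ hx ?mulr0. Qed.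

Lemma lower_sum n (J : eqType) (r : seq J) (P : pred J) (F : J -> alg) :
  (forall j, j \in r -> P j -> lower n (F j)) -> lower n (\sum_(j <- r | P j) F j).
Proof.
move=> h c hc; rewrite raddf_sum big_seq_cond big1 // => j /andP[jr Pj].
exact: h.
Qed.

Lemma lower_basis n c : (class_ncomp c < n)%N -> lower n (basis K c).
Proof.
move=> hc c' hc'; rewrite mcoeffU; case: eqP => // e.
by rewrite e ltnNge hc' in hc.
Qed.

Lemma lowerW n k x : (n <= k)%N -> lower n x -> lower k x.
Proof. by move=> nk h c /(leq_trans nk)/h. Qed.

Lemma class_compose_lead a b :
  lower (class_ncomp a + class_ncomp b)
    (class_compose K a b - basis K (class_union a b)).
Proof.
(* The empty matching is admissible because gluing along it is the disjoint union, which is a rule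
   diagram. *)
have ax0 : `[< [/\ one_to_one (set0 : {set vtx (rhs (rep b)) * vtx (lhs (rep a))}),
    one_to_one (set0 : {set edg (rhs (rep b)) * edg (lhs (rep a))}) &
    is_rule_diagram (diagram_glue (A := rep a) (B := rep b) (set0, set0))] >].
  apply/asboolP; split; try by move=> ? ?; rewrite inE.
  by rewrite diagram_glue0; apply: is_rule_diagram_sum; apply: rd_axioms.
pose m0 : matching (rep a) (rep b) := exist _ (set0, set0) ax0.
rewrite /class_compose (bigD1 m0) //=.
have -> : class_of (glue m0) = class_union a b.
  by apply/class_of_eq; rewrite /= diagram_glue0; exact: diagram_iso_refl.
(* The union term has cancelled; any matching other than [m0] is nonempty, so [ncomp_glue] applies
   to it. *)
rewrite addrAC subrr add0r; apply: lower_sum => m _ nm; apply: lower_basis.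
by rewrite class_ncomp_of; apply: ncomp_glue.
Qed.

Lemma class_compose_lower a b :
  lower (class_ncomp a + class_ncomp b).+1 (class_compose K a b).
Proof.
rewrite -[class_compose _ _ _](subrK (basis K (class_union a b))).
apply: lowerD; first exact: (lowerW (leqnSn _) (@class_compose_lead a b)).
by apply: lower_basis; rewrite class_ncomp_union.
Qed.

Lemma compose_basis a (y : alg) :
  compose (basis K a) y = lext (class_compose K a) y.
Proof.
rewrite /compose msuppU oner_eq0 big_seq_fset1 mcoeffUU.
by apply: eq_bigr => b _; rewrite mul1r.
Qed.

Lemma compose_basis_lower a n (y : alg) :
  lower n y -> lower (class_ncomp a + n) (compose (basis K a) y).
Proof.
move=> hy; rewrite compose_basis; apply: lower_sum => b + _.
rewrite -mcoeff_neq0 => nb; apply: lowerZ; apply: (lowerW _ (@class_compose_lower _ _)).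
(* The successor in [class_compose_lower] turns the bound into [class_ncomp b < n], which holds on
   the support of [y]. *)
rewrite -addnS leq_add2l ltnNge; apply: contraNN nb => nb.
by apply/eqP; apply: hy.
Qed.

(** The product associates to the right and ends in the unit, so each factor acts by left
    composition with a basis vector, the case treated by [compose_basis]. *)
Definition mon (s : seq primitive_class) : alg :=
  \big[@compose K/basis K class_empty]_(q <- s) basis K (val q).

(** By induction on the word: left composition with a primitive raises the bound on the error term
    by one, and its product with the leading diagram is the next leading diagram up to fewer
    components. *)
Lemma mon_lead s : lower (size s) (mon s - basis K (class_word s)).
Proof.
elim: s => [|q s IHs]; first by rewrite /mon /class_word !big_nil subrr => c _;
  exact: mcoeff0.
rewrite /mon /class_word !big_cons -/(mon s) -/(class_word s).
have -> : size (q :: s) = (class_ncomp (val q) + size s)%N.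
  by rewrite class_ncomp_primitive.
rewrite -[mon s](subrK (basis K (class_word s))) compose_basis lextD -addrA.
apply: lowerD; first by rewrite -compose_basis; apply: compose_basis_lower.
by rewrite lextU scale1r -(class_ncomp_word s); apply: class_compose_lead.
Qed.
End Composition.

(** * Triangularity *)

Section OrderedMonomials.
Variables (K : fieldType) (disp : Order.disp_t) (IP : orderType disp).
Variables (dP : IP -> primitive_class) (dP_bij : bijective dP).
Local Notation word_class w := (class_word (map dP w)).
Local Notation word_mon w := (mon K (map dP w)).

Lemma sorted_word_exists (c : diagram_class) :
  exists2 w : seq IP, sorted <=%O w & word_class w = c.
Proof.
have [s ->] := class_decomposition c; have [pd _ pdK] := dP_bij.
exists (sort <=%O (map pd s)); first exact: sort_sorted Order.TotalTheory.le_total _.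
apply/class_word_perm; rewrite -[X in perm_eq _ X](mapK pdK).
by apply: perm_map; rewrite perm_sort.
Qed.

(** Equal classes have words that are permutations of each other, and a sorted word is determined by
    its letters with multiplicity. *)
Lemma sorted_word_inj (v w : seq IP) : sorted <=%O v -> sorted <=%O w ->
  word_class v = word_class w -> v = w.
Proof.
move=> sv sw /class_word_perm/(perm_map_inj (bij_inj dP_bij)).
exact: (sorted_eq Order.POrderTheory.le_trans Order.POrderTheory.le_anti).
Qed.

(** The empty word is a legitimate index: its monomial is the unit, so its coefficient plays the
    role of $t_0$. *)
Definition ordered_sum : {malg K[seq IP]} -> rule_algebra K :=
  lext (fun w => word_mon w).

(** Unitriangularity: if [w] is at least as long as [v], its class lies outside the error term of
    [mon_lead], so only the leading diagram of [v] can contribute. *)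
Lemma word_mon_coeff (v w : seq IP) : sorted <=%O v -> sorted <=%O w ->
  (size v <= size w)%N -> (word_mon v)@_(word_class w) = (v == w)%:R.
Proof.
move=> sv sw vw; have /(_ (word_class w)) := @mon_lead K (map dP v).
rewrite class_ncomp_word !size_map mcoeffB mcoeffU => /(_ vw)/eqP.
rewrite subr_eq0 => /eqP->; congr (_ *+ nat_of_bool _).
by apply/eqP/eqP => [/sorted_word_inj->|->].
Qed.

(** Linear independence of the sorted monomials, from which uniqueness of the coefficients
    follows. *)
Lemma ordered_sum_inj0 (x : {malg K[seq IP]}) :
  (forall w, w \in msupp x -> sorted <=%O w) -> ordered_sum x = 0 -> x = 0.
Proof.
move=> hs x0; apply/malgP => w; rewrite mcoeff0; apply/eqP.
apply/negPn; rewrite mcoeff_neq0; apply/negP => wx.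
have bnd n : (exists2 u, u \in msupp x & size u == n) ->
    (n <= \max_(u <- msupp x) size u)%N.
  by case=> u ux /eqP <-; apply: leq_bigmax_seq.
have ex : exists n, `[< exists2 u, u \in msupp x & size u == n >].
  by exists (size w); apply/asboolP; exists w.
(* In a word of maximal size no lower order term of another monomial interferes. *)
have [n /asboolP[u ux /eqP un] nmax] := ex_maxnP ex (fun n h => bnd n (asboolW h)).
have /eqP := congr1 (mcoeff (word_class u)) x0; rewrite mcoeff0 raddf_sum.
rewrite (big_fsetD1 u) //= big1_fset => [|v].
  rewrite mcoeffZ word_mon_coeff ?hs // eqxx mulr1 addr0.
  by rewrite mcoeff_eq0 ux.
rewrite in_fsetD1 => /andP[vu vx] _; rewrite mcoeffZ word_mon_coeff ?hs //.
  by rewrite (negbTE vu) mulr0.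
by rewrite un; apply: nmax; apply/asboolP; exists v.
Qed.

(** Each diagram in [y] is replaced by the monomial of its sorted word; the remainder has fewer
    components and is handled by induction. The bound on the sizes of words later limits the range
    of the outer sum. *)
Lemma ordered_sum_onto n (y : rule_algebra K) : lower n y ->
  exists2 x : {malg K[seq IP]},
    (forall w, w \in msupp x -> sorted <=%O w && (size w < n)%N) &
    ordered_sum x = y.
Proof.
elim: n y => [|n IHn] y hy.
  exists 0 => [w|]; first by rewrite msupp0.
  by rewrite /ordered_sum lext0; apply/malgP => c; rewrite hy ?mcoeff0.
(* [inhabited] allows a sorted word to be chosen for all classes at once, as data, while the goal is
   a proposition. *)
have [/all_sig2[wd sw wdE]] : inhabited (forall c : diagram_class,
    {w : seq IP | sorted <=%O w & word_class w = c}).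
  by split=> c; apply: cid2; exact: sorted_word_exists.
pose x1 : {malg K[seq IP]} := \sum_(c <- msupp y) << y@_c *g wd c >>.
have ox1 : ordered_sum x1 = \sum_(c <- msupp y) y@_c *: word_mon (wd c).
  by rewrite /ordered_sum lext_sum; apply: eq_bigr => c _; rewrite lextU.
have sy c : c \in msupp y -> (class_ncomp c <= n)%N.
  rewrite -mcoeff_neq0 => nc; rewrite leqNgt; apply: contraNN nc => nc.
  by apply/eqP; apply: hy.
have size_wd c : size (wd c) = class_ncomp c.
  by rewrite -{2}[c]wdE class_ncomp_word size_map.
have [|x2 hx2 ox2] := IHn (y - ordered_sum x1).
  (* Termwise, the remainder is a scalar multiple of the error term of the monomial of [wd c], which
     lies below the component count of [c], itself at most [n]. *)
  rewrite ox1 [X in X - _]monalgE -sumrB; apply: lower_sum => c cy _.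
  have -> : << y@_c *g c >> = y@_c *: basis K c :> rule_algebra K.
    by apply/malgP => c'; rewrite mcoeffZ !mcoeffU mulr_natr.
  rewrite -scalerBr -opprB; apply: lowerZ; rewrite -scaleN1r; apply: lowerZ.
  rewrite -[in basis _ _](wdE c); apply: lowerW (@mon_lead K _).
  by rewrite size_map size_wd sy.
exists (x1 + x2); last by rewrite /ordered_sum lextD [X in _ + X]ox2 addrC subrK.
move=> w /(fsubsetP (msuppD_le _ _)); rewrite in_fsetU => /orP[|/hx2/andP[-> /ltnW]] //.
(* Otherwise every summand of [x1] would vanish at [w]. *)
rewrite -mcoeff_neq0 => nw; have [c cy wE] : exists2 c, c \in msupp y & w = wd c.
  apply: contrapT => h; case/eqP: nw; rewrite raddf_sum big_seq big1 // => c cy.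
  rewrite /= mcoeffU; case: eqP => // e; case: h; exists c => //.
by rewrite wE sw size_wd ltnS sy.
Qed.

End OrderedMonomials.

(** * Existence and uniqueness of the coefficients *)

Lemma sum_by_size (T : eqType) (V : nmodType) (r : seq (seq T))
    (P : pred (seq T)) (n : nat) (F : seq T -> V) :
  {in r, forall w, (1 <= size w <= n)%N && P w} ->
  \sum_(1 <= i < n.+1) \sum_(w <- r | (size w == i) && P w) F w
  = \sum_(w <- r) F w.
Proof.
(* After the exchange, the only index [i] that keeps a given word is its length, which lies in the
   range. *)
move=> h; rewrite (exchange_big_dep predT) //=.
apply: eq_big_seq => w /h /andP[wn Pw].
rewrite (eq_bigl (fun i => i == size w)) => [|i]; last by rewrite Pw andbT eq_sym.
by rewrite big_nat1_eq ltnS wn.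
Qed.

Theorem theorem4p1 (K : fieldType)
    (prec : rel primitive_class)
    (prec_irr : irreflexive prec)
    (prec_trans : transitive prec)
    (prec_total : forall c1 c2 : primitive_class,
       c1 != c2 -> prec c1 c2 || prec c2 c1)
    (disp : Order.disp_t) (IP : orderType disp)
    (dP : IP -> primitive_class)
    (dP_bij : bijective dP)
    (dP_prec : forall p q : IP, (p < q)%O = prec (dP p) (dP q))
    (d : diagram_class) (nc : nat) (p : 'I_nc -> IP)
    (d_eq : d = \big[class_union/class_empty]_(i < nc) val (dP (p i))) :
  exists! t : K * {fsfun seq IP -> K with 0},
    (forall w : seq IP, w \in finsupp t.2 ->
       (1 <= size w <= nc)%N && sorted <=%O w) /\
    basis K d =
      t.1 *: basis K class_empty +
      \sum_(1 <= i < nc.+1)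
        \sum_(w <- finsupp t.2 | (size w == i) && sorted <=%O w)
          t.2 w *: \big[@compose K/basis K class_empty]_(q <- w)
                      basis K (val (dP q)).
Proof.
(* Both parts of [t] are packed into one combination of words, with [t.1] placed at the empty
   word. *)
pose coeffs (t : K * {fsfun seq IP -> K with 0}) : {malg K[seq IP]} :=
  << t.1 *g [::] >> + mkmalg t.2.
have sumE t : (forall w : seq IP, w \in finsupp t.2 ->
      (1 <= size w <= nc)%N && sorted <=%O w) ->
    t.1 *: basis K class_empty +
      \sum_(1 <= i < nc.+1)
        \sum_(w <- finsupp t.2 | (size w == i) && sorted <=%O w)
          t.2 w *: \big[@compose K/basis K class_empty]_(q <- w)
                      basis K (val (dP q))
    = ordered_sum dP (coeffs t).
  move=> ht; rewrite sum_by_size // /ordered_sum lextD lextU /mon big_nil.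
  by congr (_ + _); apply: eq_bigr => w _; rewrite big_map.
(* Each of the [nc] primitives contributes one component, so the expansion of [d] needs only words
   of length at most [nc]. *)
have d_ncomp : class_ncomp d = nc.
  rewrite d_eq -[RHS](size_enum_ord nc) -(size_map (dP \o p)) -class_ncomp_word.
  by rewrite /class_word big_map big_enum.
have [x hx xd] := ordered_sum_onto dP_bij (lower_basis K (ltnSn (class_ncomp d))).
rewrite {}d_ncomp in hx.
(* Subtracting the term at the empty word leaves only words of length at least 1 in the second
   part. *)
pose t := (x@_[::], malg_val (x - << x@_[::] *g [::] >>)).
have coeffs_t : coeffs t = x.
  apply/malgP => w; rewrite mcoeffD.
  by rewrite -[X in _ + X]/((x - << x@_[::] *g [::] >>)@_w) mcoeffB addrC subrK.
have ht w : w \in finsupp t.2 -> (1 <= size w <= nc)%N && sorted <=%O w.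
  rewrite -[_ \in _]/(w \in msupp (x - << x@_[::] *g [::] >>)) -mcoeff_neq0 mcoeffB mcoeffU.
  case: w => [|q w]; first by rewrite eqxx subrr eqxx.
  by rewrite subr0 mcoeff_neq0 => /hx/andP[-> ?]; rewrite andbT.
exists t; split=> [|t' [ht' t'd]]; first by split=> //; rewrite sumE // coeffs_t.
rewrite sumE // in t'd.
(* Injectivity of [ordered_sum] is known on sorted words only; the added empty word is sorted. *)
have coeffs_sorted u : (forall w : seq IP, w \in finsupp u.2 ->
      (1 <= size w <= nc)%N && sorted <=%O w) ->
    forall w, w \in msupp (coeffs u) -> sorted <=%O w.
  move=> hu w /(fsubsetP (msuppD_le _ _)); rewrite in_fsetU => /orP[|/hu/andP[]//].
  by move/(fsubsetP msuppU_le); rewrite in_fset1 => /eqP->.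
have e : coeffs t = coeffs t'.
  apply/eqP; rewrite -subr_eq0; apply/eqP; apply: (ordered_sum_inj0 dP_bij).
    by move=> w /(fsubsetP (msuppB_le _ _)); rewrite in_fsetU => /orP[];
      apply: coeffs_sorted.
  by rewrite [LHS]lextD lextN [X in _ - X](esym t'd) coeffs_t [X in X - _]xd subrr.
(* The support of [u.2] excludes the empty word, so the coefficient there is [u.1] alone. *)
have coeffs1 u : (forall w : seq IP, w \in finsupp u.2 ->
      (1 <= size w <= nc)%N && sorted <=%O w) -> (coeffs u)@_[::] = u.1.
  move=> hu; rewrite mcoeffD mcoeffUU [X in _ + X]mcoeff_outdom ?addr0 //.
  by apply/negP => /hu.
have e1 : t.1 = t'.1 by rewrite -(coeffs1 _ ht) e coeffs1.
have e2 : t.2 = t'.2 by move: e; rewrite /coeffs e1 => /addrI[].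
by rewrite (surjective_pairing t) e1 e2 -surjective_pairing.
Qed.
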